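(* Let $n \ge 3$ and $m \ge 1$ be integers, let $0<\alpha<1$, and let $\hat{\tau} \ge 1$ be a real number. Then, based on $2n$ exact samples from $\pi$ and $2mn$ steps of the $K$-chain, one can construct an interval $I$ as follows. There are real-valued functions $L \le U$ of $2n(m+1)$ variables in $[0,1]$, depending only on $n,m,\alpha,\hat{\tau}$ (and not on $S,\pi,K,g$), such that for every finite set $S$, every probability distribution $\pi=(\pi_i)_{i\in S}$ on $S$, every transition matrix $K=(k_{ij})_{i,j\in S}$ on $S$ with $\pi_i k_{ij}=\pi_j k_{ji}$ for all $i,j\in S$, and every function $g:S\to\mathbb{R}$ with $0\le g\le 1$, the following holds. Let $(X^{(r)}_j)_{j=0}^{m}$, $1\le r\le 2n$, be $2n$ independent Markov chains with transition matrix $K$, each with initial state $X^{(r)}_0$ distributed according to $\pi$. Let $I=[L,U]$ with $L,U$ evaluated at the array $\bigl(g(X^{(r)}_j)\bigr)_{1\le r\le 2n,\,0\le j\le m}$. Then $$\mathbf{P}\left(\bar{g}\notin I\right)\le \alpha$$ and $$\mathbf{P}\left(\mathrm{length}(I) > k_\alpha\, \max\left(\tfrac1n,\sqrt{\tfrac{\hat{\tau}}{nm}}\right)\log n\right)\le 3n(n+1)\exp\left(-\frac{m}{48\,n\,\tau_2}\log^2 n\right),$$ where $\bar{g}=\sum_{i\in S}\pi_i g(i)$, $k_\alpha := 2\left(\sqrt{2/\alpha}+\log(4/\alpha)\right)$, and $\tau_2$ is the relaxation time of $K$.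
   Context: $\log$ is the natural logarithm and $\log^2 n=(\log n)^2$. The matrix $K$ is not assumed irreducible. Relaxation time: let $1=\lambda_1\ge\lambda_2\ge\cdots\ge\lambda_s\ge -1$ ($s=|S|$) be the eigenvalues of $K$, with multiplicity; then $\tau_2:=(1-\lambda_2)^{-1}$, with $\tau_2=\infty$ (and $1/\tau_2=0$) if $\lambda_2=1$. Assertions involving $\tau_2$ are made when this definition makes sense, i.e. $|S|\ge 2$ and all eigenvalues of $K$ are real (the latter is automatic when $\pi_i>0$ for all $i$). *)

(* Defs.v *)
From HB Require Import structures.
From mathcomp Require Import all_boot all_order all_algebra.
From mathcomp Require Import all_classical all_reals all_analysis.
Set Implicit Arguments.
Unset Strict Implicit.
Unset Printing Implicit Defensive.
Import Order.TTheory GRing.Theory Num.Theory.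

Local Open Scope classical_set_scope.
Local Open Scope ring_scope.

Definition is_distribution (R : realType) (S : finType) (pi : S -> R) : Prop :=
  (forall i, 0 <= pi i) /\ \sum_i pi i = 1.

Definition is_transition_matrix (R : realType) (S : finType) (K : S -> S -> R)
    : Prop :=
  forall i, is_distribution (K i).

Definition reversible (R : realType) (S : finType) (pi : S -> R)
    (K : S -> S -> R) : Prop :=
  forall i j, pi i * K i j = pi j * K j i.

Definition kernel_mx (R : realType) (S : finType) (K : S -> S -> R)
    : 'M[R]_#|S| :=
  \matrix_(i, j) K (enum_val i) (enum_val j).

(* [lambda] lists the eigenvalues of [K], with algebraic multiplicity, in
   nonincreasing order.  Such a real list exists iff all the complex
   eigenvalues of [K] are real. *)
Definition eigenvalues (R : realType) (S : finType) (K : S -> S -> R)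
    (lambda : seq R) : Prop :=
  sorted >=%R lambda /\
  char_poly (kernel_mx K) = \prod_(z <- lambda) ('X - z%:P).

(* As [lambda] is numbered from 0, [lambda`_1] is the second largest
   eigenvalue; it is meaningful when [lambda] has at least two entries. *)
Definition relaxation_time (R : realType) (lambda : seq R) : \bar R :=
  if lambda`_1 == 1 then +oo%E else ((1 - lambda`_1)^-1)%:E.

(* A chain X_0, ..., X_m with initial law [pi] and transition matrix [K].  The
   Markov property is multiplied out, so that it does not require conditioning
   on null events: P(X_0 = x_0, ..., X_(j+1) = x_(j+1)) is
   P(X_0 = x_0, ..., X_j = x_j) * K x_j x_(j+1). *)
Definition markov_chain d (T : measurableType d) (R : realType)
    (P : probability T R) (S : finType) (pi : S -> R) (K : S -> S -> R)
    (m : nat) (X : 'I_m.+1 -> T -> S) : Prop :=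
  [/\ forall j s, measurable [set t | X j t = s],
      forall s, P [set t | X ord0 t = s] = (pi s)%:E
    & forall (x : 'I_m.+1 -> S) (j : 'I_m),
        P [set t | forall i : 'I_m.+1, (i <= j.+1)%N -> X i t = x i] =
        (P [set t | forall i : 'I_m.+1, (i <= j)%N -> X i t = x i] *
         (K (x (inord j)) (x (inord j.+1)))%:E)%E].

(* Mutual independence of random elements of a finite (discrete) type. *)
Definition mutually_independent d (T : measurableType d) (R : realType)
    (P : probability T R) (I V : finType) (Y : I -> T -> V) : Prop :=
  forall (J : {set I}) (A : I -> set V),
    P [set t | forall r, r \in J -> A r (Y r t)] =
    (\prod_(r in J) P [set t | A r (Y r t)])%E.

Definition independent_markov_chains d (T : measurableType d) (R : realType)
    (P : probability T R) (S : finType) (pi : S -> R) (K : S -> S -> R)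
    (N m : nat) (X : 'I_N -> 'I_m.+1 -> T -> S) : Prop :=
  (forall r, markov_chain P pi K (X r)) /\
  mutually_independent P
    (fun r t => [ffun j => X r j t] : {ffun 'I_m.+1 -> S}).

Definition k_const (R : realType) (alpha : R) : R :=
  2 * (Num.sqrt (2 / alpha) + ln (4 / alpha)).

(* Main.v *)
(* Averaging [g] along each chain gives [2n] i.i.d. values in [0, 1] with mean
   [gbar].  The first [n] values provide a range [a, b], the other [n] are
   clamped to [a, b] and averaged; the interval is centered at this average,
   with radius [ln (4 / alpha) / n + (b - a) * sqrt (2 / alpha) / (2 sqrt n)].

   Coverage: a further value falls below [a] with probability more than [y]
   only with probability at most [exp (- n y)], and likewise above [b], so that
   clamping shifts the mean by at most [ln (4 / alpha) / n] outside an event of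
   probability [alpha / 2]; Chebyshev's inequality, with the variance bound
   [(b - a)^2 / 4], accounts for the other [alpha / 2].

   Length: it is small enough unless some pilot average deviates from [gbar] by
   more than [ln n / sqrt n].  The moment generating function of a chain sum is
   [<1, d (K d)^m 1>] in [L^2(pi)], with [d = exp (theta f)].  The spectral gap
   bounds the form [<u, K u>] by [rho <u, u / d>], hence the norm of [K d] on
   [L^2(pi d)] by [rho = 1 + O(theta^2 / gap)].  The gap inequality
   comes from a maximizer of the Rayleigh quotient on mean-zero functions
   supported by [pi], which yields a left eigenvector of [K]. *)

Require Import Defs.
From HB Require Import structures.
From mathcomp Require Import all_boot all_order all_algebra.
From mathcomp Require Import all_classical all_reals all_analysis.
From mathcomp Require Import ring lra.
Import Order.TTheory GRing.Theory Num.Theory.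
Set Implicit Arguments.
Unset Strict Implicit.
Unset Printing Implicit Defensive.
Import numFieldNormedType.Exports.
Local Open Scope classical_set_scope.
Local Open Scope ring_scope.

(** * Spectral gap of a reversible kernel *)

Lemma char_poly_block_lower (F : fieldType) m k (B : 'M[F]_m) (C : 'M[F]_(k, m))
    (D : 'M[F]_k) :
  char_poly (block_mx B 0 C D) = char_poly B * char_poly D.
Proof.
rewrite /char_poly /char_poly_mx scalar_mx_block map_block_mx opp_block_mx.
by rewrite add_block_mx map_mx0 oppr0 addr0 det_lblock.
Qed.

(** Scalar matrices commute with [P], so the relation lifts to characteristic matrices; the
    determinant of [P], a nonzero constant polynomial, then cancels. *)
Lemma char_poly_similar (F : fieldType) n (P A B : 'M[F]_n) :
  P \in unitmx -> P *m A = B *m P -> char_poly A = char_poly B.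
Proof.
move=> Pu PA; pose Q := map_mx polyC P : 'M[{poly F}]_n.
have /(congr1 determinant) : Q *m char_poly_mx A = char_poly_mx B *m Q.
  by rewrite mulmxBr mulmxBl scalar_mxC -!map_mxM PA.
rewrite !det_mulmx [RHS]mulrC; apply: mulfI.
by rewrite det_map_mx polyC_eq0 -unitfE -unitmxE.
Qed.

(** Completing the rows of [V] by a basis of a complement gives an invertible [P] that conjugates
    [A] into a block lower triangular matrix with upper left block [B]. *)
Lemma char_poly_stable_dvd (F : fieldType) m n (V : 'M[F]_(m, n)) (A : 'M[F]_n)
    (B : 'M[F]_m) :
  row_free V -> V *m A = B *m V -> char_poly B %| char_poly A.
Proof.
move=> Vf VA; have [k nE] : exists k, n = (m + k)%N.
  by exists (n - m)%N; rewrite subnKC //; move/eqP: Vf => <-;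
    exact: rank_leq_col.
subst n.
have rC : \rank (V^C)%MS = k.
  by rewrite mxrank_compl (eqP Vf) addKn.
pose C := castmx (rC, erefl) (row_base (V^C)%MS) : 'M[F]_(k, m + k).
have CE : (C :=: V^C)%MS by apply: eqmx_trans (eqmx_cast _ _) (eq_row_base _).
pose P := col_mx V C.
have Pu : P \in unitmx.
  rewrite -row_full_unit -sub1mx -addsmxE.
  by rewrite (adds_eqmx (eqmx_refl V) CE) sub1mx addsmx_compl_full.
have PAE : P *m A = block_mx B 0 (lsubmx (C *m A *m invmx P))
    (rsubmx (C *m A *m invmx P)) *m P.
  rewrite mul_col_mx VA block_mxEv mul_col_mx; congr col_mx.
    by rewrite mul_row_col mul0mx addr0.
  by rewrite hsubmxK mulmxKV.
by rewrite (char_poly_similar Pu PAE) char_poly_block_lower dvdp_mulr.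
Qed.

(** Eigenvectors are row vectors here, and multiplying a row vector by a stochastic matrix does not
    increase its l^1 norm. *)
Lemma stochastic_eigenvalue_le1 (R : realFieldType) n (A : 'M[R]_n) (z : R) :
  (forall i j, 0 <= A i j) -> (forall i, \sum_j A i j = 1) ->
  eigenvalue A z -> `|z| <= 1.
Proof.
move=> A0 A1 /eigenvalueP[v vA v0].
have v1 : 0 < \sum_j `|v 0 j|.
  rewrite lt_def sumr_ge0 ?andbT // psumr_eq0 //; apply: contra v0 => /allP v0.
  apply/eqP/rowP => j; rewrite mxE; apply/eqP; rewrite -normr_eq0.
  by have := v0 j (mem_index_enum _).
rewrite -(ler_pM2r v1) mul1r mulr_sumr.
have -> : \sum_j `|v 0 j| = \sum_j \sum_i `|v 0 i| * A i j.
  by rewrite exchange_big; apply: eq_bigr => i _; rewrite -mulr_sumr A1 mulr1.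
apply: ler_sum => j _; rewrite -normrM.
have -> : z * v 0 j = \sum_i v 0 i * A i j.
  by have := congr1 (fun M : 'rV_n => M 0 j) vA; rewrite !mxE.
rewrite (le_trans (ler_norm_sum _ _ _)) //; apply: ler_sum => i _.
by rewrite normrM (ger0_norm (A0 i j)).
Qed.

Lemma row_dotE (R : nzRingType) n (y z : 'rV[R]_n) :
  (y *m z^T) 0 0 = \sum_i y 0 i * z 0 i.
Proof. by rewrite mxE; apply: eq_bigr => i _; rewrite mxE. Qed.

Lemma row_dot_gt0 (R : realFieldType) n (z : 'rV[R]_n) :
  z != 0 -> 0 < (z *m z^T) 0 0.
Proof.
move=> z0; rewrite row_dotE lt_def sumr_ge0 ?andbT => [|i _]; last exact: sqr_ge0.
rewrite psumr_eq0 => [|i _]; last exact: sqr_ge0.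
apply: contra z0 => /allP z0; apply/eqP/rowP => j; rewrite mxE; apply/eqP.
by have := z0 j (mem_index_enum _); rewrite mulf_eq0 orbb.
Qed.

Lemma continuous_pointwise_mul (R : realType) (T : topologicalType)
    (f g : T -> R) :
  continuous f -> continuous g -> continuous (fun x => f x * g x).
Proof. by move=> cf cg x; exact: continuousM (cf x) (cg x). Qed.

Lemma continuous_mulmx_coord (R : realType) m n p (A : 'M[R]_(n, p)) i j :
  continuous (fun z : 'M[R]_(m, n) => (z *m A) i j).
Proof.
have -> : (fun z : 'M[R]_(m, n) => (z *m A) i j) =
    (fun z => \sum_k z i k * A k j) by apply/funext => z; rewrite mxE.
apply: continuous_big => [|k _]; first exact: add_continuous.
apply: continuous_pointwise_mul; first exact: coord_continuous.
exact: cst_continuous.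
Qed.

Lemma continuous_form (R : realType) n (A : 'M[R]_n) :
  continuous (fun z : 'rV[R]_n => (z *m A *m z^T) 0 0).
Proof.
have -> : (fun z : 'rV[R]_n => (z *m A *m z^T) 0 0) =
    (fun z => \sum_k (z *m A) 0 k * z 0 k) by apply/funext => z; rewrite row_dotE.
apply: continuous_big => [|k _]; first exact: add_continuous.
apply: continuous_pointwise_mul; first exact: continuous_mulmx_coord.
exact: coord_continuous.
Qed.

(* The eigenvector is a maximizer of the Rayleigh quotient on the subspace. *)
Lemma symmetric_top_eigenvector (R : realType) n p (M : 'M[R]_n)
    (C : 'M[R]_(n, p)) (z0 : 'rV[R]_n) :
  M^T = M -> (forall z : 'rV_n, z *m C = 0 -> z *m M *m C = 0) ->
  z0 != 0 -> z0 *m C = 0 ->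
  exists mu (z : 'rV[R]_n), [/\ z != 0, z *m C = 0, z *m M = mu *: z &
    forall y : 'rV_n, y *m C = 0 ->
      (y *m M *m y^T) 0 0 <= mu * (y *m y^T) 0 0].
Proof.
move=> Msym MC z0n z0C.
pose A := [set z : 'rV[R]_n | z *m C = 0 /\ (z *m z^T) 0 0 = 1].
have normalize (y : 'rV[R]_n) : y != 0 -> y *m C = 0 ->
    A ((Num.sqrt ((y *m y^T) 0 0))^-1 *: y).
  move=> y0 yC; split; first by rewrite -scalemxAl yC scaler0.
  rewrite linearZ -scalemxAl -scalemxAr scalerA mxE -invfM -expr2.
  rewrite sqr_sqrtr ?mulVf ?ltW ?row_dot_gt0 //.
  by rewrite gt_eqF // row_dot_gt0.
have A0 : A !=set0 by eexists; exact: normalize z0n z0C.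
have cA : compact A.
  apply: bounded_closed_compact.
    exists 1; split; first exact: num_real.
    move=> x x1 z [_ z1]; rewrite /= [leLHS]/Num.norm /= mx_normrE.
    apply: bigmax_le => [|[i j] _ /=].
      exact: le_trans (ltW x1).
    apply: le_trans (ltW x1); rewrite -(@ler_pXn2r _ 2) ?nnegrE // expr1n.
    rewrite ord1 -z1 row_dotE (bigD1 j) //= -normrX ger0_norm ?sqr_ge0 //.
    by rewrite expr2 lerDl sumr_ge0 // => k _; exact: sqr_ge0.
  have -> : A = (\bigcap_(j in [set: 'I_p]) (fun z : 'rV[R]_n => (z *m C) 0 j)
       @^-1` [set 0]) `&` (fun z : 'rV[R]_n => (z *m z^T) 0 0) @^-1` [set 1].
    apply/seteqP; split => z [zC z1]; split => //.
      by move=> j _ /=; rewrite zC mxE.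
    by apply/rowP => j; rewrite [RHS]mxE; exact: (zC j I).
  apply: closedI.
    apply: closed_bigI => j _; apply: preimage_closed; last exact: closed_eq.
    by move=> z _; exact: continuous_mulmx_coord.
  apply: preimage_closed; last exact: closed_eq.
  move=> z _; have := @continuous_form _ _ (1%:M : 'M[R]_n) z.
  by under eq_fun do rewrite mulmx1.
have [|z] := compact_EVT_max A0 cA
    (f := fun z : 'rV[R]_n => (z *m M *m z^T) 0 0).
  by apply: continuous_subspaceT; exact: continuous_form.
rewrite inE => -[zC z1] zmax.
pose mu := (z *m M *m z^T) 0 0.
have mumax (y : 'rV[R]_n) : y *m C = 0 ->
    (y *m M *m y^T) 0 0 <= mu * (y *m y^T) 0 0.
  move=> yC; have [->|y0] := eqVneq y 0.
    by rewrite !mul0mx mxE mulr0.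
  have := zmax _ (mem_set (normalize y y0 yC)).
  rewrite linearZ -!scalemxAl -!scalemxAr !scalerA mxE -invfM -expr2.
  have y2 := row_dot_gt0 y0; rewrite sqr_sqrtr ?(ltW y2) // -/mu.
  by rewrite mulrC ler_pdivrMr.
exists mu, z; split => //.
  by apply: contra_eq_neq z1 => ->; rewrite mul0mx mxE eq_sym oner_eq0.
(* First-order optimality of [z] in the direction of the residual [r]. *)
have [r rE] : exists r, r = z *m M - mu *: z by eexists.
have rC : r *m C = 0 by rewrite rE mulmxBl MC // -scalemxAl zC scaler0 subrr.
have addE (X Y : 'M[R]_1) : (X + Y) 0 0 = X 0 0 + Y 0 0 by rewrite mxE.
have scaleE a (X : 'M[R]_1) : (a *: X) 0 0 = a * X 0 0 by rewrite mxE.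
have oppE (X : 'M[R]_1) : (- X) 0 0 = - X 0 0 by rewrite mxE.
have key (t : R) : 2 * t * (r *m r^T) 0 0 <=
    t ^+ 2 * (mu * (r *m r^T) 0 0 - (r *m M *m r^T) 0 0).
  have := mumax (z + t *: r); rewrite mulmxDl zC -scalemxAl rC scaler0 addr0.
  move=> /(_ erefl).
  rewrite !mulmxDl linearD linearZ !mulmxDr -!scalemxAl -!scalemxAr !scalerA.
  rewrite !addE !scaleE -/mu z1 /=.
  have -> : (r *m z^T) 0 0 = (z *m r^T) 0 0.
    by rewrite !row_dotE; apply: eq_bigr => i _; rewrite mulrC.
  have -> : (r *m M *m z^T) 0 0 = (z *m M *m r^T) 0 0.
    rewrite -[in LHS]Msym -mulmxA -trmx_mul row_dotE [RHS]row_dotE.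
    by apply: eq_bigr => i _; rewrite mulrC.
  have -> : (r *m r^T) 0 0 = (z *m M *m r^T) 0 0 - mu * (z *m r^T) 0 0.
    by rewrite {1}rE mulmxBl -scalemxAl [LHS]addE oppE scaleE.
  rewrite expr2; lra.
have rr0 : (r *m r^T) 0 0 <= 0.
  set a := (r *m r^T) 0 0 in key *; set b := mu * _ - _ in key.
  have [b0|b0] := leP b 0.
    by have := key 1; rewrite expr1n mul1r; lra.
  (* This [t] turns [key] into 2 a^2 / b <= a^2 / b, impossible for a > 0. *)
  have := key (a / b); rewrite [a <= 0]leNgt; apply: contraTN => a0.
  rewrite -ltNge expr_div_n expr2.
  have -> : a * a / b ^+ 2 * b = a * a / b by field; rewrite gt_eqF.
  have -> : 2 * (a / b) * a = 2 * (a * a / b) by ring.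
  have : 0 < a * a / b by rewrite divr_gt0 // mulr_gt0.
  by set x := a * a / b; lra.
apply/eqP; rewrite -subr_eq0 -rE; apply: contraLR rr0 => r0.
by rewrite -ltNge row_dot_gt0.
Qed.

Lemma char_poly_scalar1 (R : comNzRingType) (a : R) :
  char_poly (a%:M : 'M[R]_1) = 'X - a%:P.
Proof. by rewrite /char_poly det_mx11 !mxE !mulr1n. Qed.

(** Divisibility, rather than membership of the roots, covers [mu = 1]. A [mu] above the second
    entry would force both 1 and [mu] to be the head of the list; cancelling one factor X - 1 leaves
    [mu] as a root among the remaining entries, which are too small. *)
Lemma le_second_root (R : realFieldType) (lambda : seq R) (mu : R) :
  sorted >=%R lambda -> (2 <= size lambda)%N ->
  (forall z, z \in lambda -> z <= 1) ->
  ('X - 1%:P) * ('X - mu%:P) %| \prod_(z <- lambda) ('X - z%:P) ->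
  mu <= lambda`_1.
Proof.
case: lambda => [|a [|b l]] //= /andP[_ srt] _ le1 dvd.
have leb z : z \in b :: l -> z <= b.
  rewrite inE => /predU1P[-> //|zl].
  have := order_path_min (fun _ _ _ h1 h2 => le_trans h2 h1) srt.
  by move=> /allP/(_ z zl).
have rootin z : root (('X - 1%:P) * ('X - mu%:P)) z -> z \in [:: a, b & l].
  by rewrite -root_prod_XsubC -!dvdp_XsubCl => /dvdp_trans; apply.
have mu_in : mu \in [:: a, b & l].
  by apply: rootin; rewrite rootM !root_XsubC eqxx orbT.
have one_in : 1 \in [:: a, b & l].
  by apply: rootin; rewrite rootM !root_XsubC eqxx.
rewrite leNgt; apply/negP => b_mu; have mu1 := le1 _ mu_in.
have eqa z : b < z -> z \in [:: a, b & l] -> z = a.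
  move=> bz; rewrite in_cons => /predU1P[//|/leb]; by rewrite leNgt bz.
have a1 := eqa _ (lt_le_trans b_mu mu1) one_in.
have amu := eqa _ b_mu mu_in.
move: dvd; rewrite big_cons -a1 amu -a1 dvdp_mul2l ?polyXsubC_eq0 //.
rewrite dvdp_XsubCl root_prod_XsubC => /leb.
by rewrite leNgt (lt_le_trans b_mu).
Qed.

Section SpectralGap.
Variables (R : realType) (S : finType) (pi : S -> R) (K : S -> S -> R).
Hypotheses (pi_distr : is_distribution pi) (K_stoch : is_transition_matrix K).
Hypothesis K_rev : reversible pi K.

Lemma stationary j : \sum_i pi i * K i j = pi j.
Proof.
under eq_bigr do rewrite K_rev.
by rewrite -mulr_sumr (K_stoch j).2 mulr1.
Qed.

Lemma sum_enum_val (F : S -> R) : \sum_(i < #|S|) F (enum_val i) = \sum_i F i.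
Proof. by rewrite -big_enum_val. Qed.

Lemma size_eigenvalues lambda : eigenvalues K lambda -> size lambda = #|S|.
Proof.
case=> _ /(congr1 (fun p : {poly R} => size p)).
by rewrite size_char_poly size_prod_XsubC => -[].
Qed.

Lemma eigenvalues_norm_le1 lambda z :
  eigenvalues K lambda -> z \in lambda -> `|z| <= 1.
Proof.
case=> _ chE zl; apply: (@stochastic_eigenvalue_le1 R #|S| (kernel_mx K)).
- by move=> i j; rewrite mxE; exact: (K_stoch _).1.
- move=> i; under eq_bigr do rewrite mxE.
  by rewrite (sum_enum_val (K (enum_val i))) (K_stoch _).2.
- by rewrite eigenvalue_root_char chE root_prod_XsubC.
Qed.

(** Since [pi] may vanish somewhere, [K] need not be similar to a symmetric matrix. Only a top
    eigenvector carried by the support is transported back to [K], and the conclusion goes through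
    divisibility of the characteristic polynomial by (X - 1)(X - mu). *)
Lemma spectral_gap lambda (w : S -> R) :
  (2 <= #|S|)%N -> eigenvalues K lambda -> \sum_i pi i * w i = 0 ->
  \sum_i \sum_j pi i * K i j * w i * w j <= lambda`_1 * \sum_i pi i * w i ^+ 2.
Proof.
move=> S2 eigK w0.
pose q (i : 'I_#|S|) : R := Num.sqrt (pi (enum_val i)).
have q2 i : q i * q i = pi (enum_val i).
  by rewrite -expr2 sqr_sqrtr ?pi_distr.1.
pose A := kernel_mx K.
have AE i j : A i j = K (enum_val i) (enum_val j) by rewrite mxE.
have q0 i j : q j = 0 -> q i * A i j = 0.
  move=> qj; have : q i * q i * A i j = 0.
    by rewrite AE q2 K_rev -q2 qj !mul0r.
  by move/eqP; rewrite -mulrA mulf_eq0 => /orP[/eqP ->|/eqP //]; rewrite mul0r.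
(* [A] is conjugated into a symmetric matrix on the support of [pi]; outside
   it, division by [q j = 0] gives a zero row and column. *)
pose M := \matrix_(i, j) (q i * A i j / q j) : 'M[R]_#|S|.
have ME i j : M i j = q i * A i j / q j by rewrite mxE.
have Msym : M^T = M.
  apply/matrixP => i j; rewrite mxE !ME.
  have [qi|qi] := eqVneq (q i) 0.
    by rewrite qi invr0 mulr0 !mul0r.
  have [qj|qj] := eqVneq (q j) 0.
    by rewrite qj invr0 mulr0 !mul0r.
  apply: (mulIf qi); apply: (mulIf qj).
  have -> : q j * A j i / q i * q i * q j = q j * q j * A j i by field.
  have -> : q i * A i j / q j * q i * q j = q i * q i * A i j by field.
  by rewrite !q2 !AE K_rev.
pose sq := \row_j q j.
pose off := diag_mx (\row_j (q j == 0)%:R) : 'M[R]_#|S|.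
(* Orthogonality to [sq] encodes mean zero. Vanishing off the support keeps [z] nonzero after
   multiplication by [q], which yields the eigenvector [v] below. *)
pose C := row_mx sq^T off.
have sqM : sq *m M = sq.
  apply/rowP => j; rewrite !mxE.
  under eq_bigr => i _ do rewrite !mxE -/(q i) 2!mulrA q2.
  have [qj|qj] := eqVneq (q j) 0.
    by rewrite big1 // => i _; rewrite qj invr0 mulr0.
  rewrite -mulr_suml.
  rewrite (sum_enum_val (fun i => pi i * K i (enum_val j))) stationary -q2.
  by rewrite mulfK.
have CP (z : 'rV[R]_#|S|) : z *m C = 0 <->
    \sum_i z 0 i * q i = 0 /\ forall i, q i = 0 -> z 0 i = 0.
  rewrite mul_mx_row; split => [/eqP|[zq zo]].
    rewrite row_mx_eq0 => /andP[/eqP zs /eqP zo]; split.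
      transitivity ((z *m sq^T) 0 0); last by rewrite zs mxE.
      by rewrite row_dotE; apply: eq_bigr => i _; rewrite [sq _ _]mxE.
    move=> i qi; have := congr1 (fun M : 'rV[R]_#|S| => M 0 i) zo.
    by rewrite mul_mx_diag !mxE qi eqxx mulr1.
  apply/eqP; rewrite row_mx_eq0; apply/andP; split; apply/eqP.
    apply/matrixP => i j; rewrite !ord1 row_dotE [RHS]mxE -[RHS]zq.
    by apply: eq_bigr => k _; rewrite mxE.
  rewrite mul_mx_diag; apply/rowP => i; rewrite !mxE.
  by case: eqP => [/zo ->|]; rewrite ?mul0r ?mulr0.
have MC (z : 'rV[R]_#|S|) : z *m C = 0 -> z *m M *m C = 0.
  move=> /CP[zq zo]; apply/CP; split.
    transitivity ((z *m M *m sq^T) 0 0).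
      by rewrite row_dotE; apply: eq_bigr => i _; rewrite [sq _ _]mxE.
    have -> : z *m M *m sq^T = z *m sq^T.
      by rewrite -mulmxA -[in LHS]Msym -trmx_mul sqM.
    by rewrite row_dotE -[RHS]zq; apply: eq_bigr => i _; rewrite [sq _ _]mxE.
  by move=> i qi; rewrite mxE big1 // => k _; rewrite ME qi invr0 !mulr0.
pose z0 := \row_i (q i * w (enum_val i)).
have z0C : z0 *m C = 0.
  apply/CP; split => [|i qi]; last by rewrite mxE qi mul0r.
  rewrite -[RHS]w0 -sum_enum_val; apply: eq_bigr => i _.
  by rewrite mxE -q2; ring.
have formE : (z0 *m M *m z0^T) 0 0 = \sum_i \sum_j pi i * K i j * w i * w j.
  rewrite row_dotE -(sum_enum_val (fun i => \sum_j _)).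
  under eq_bigr => j _ do rewrite mxE mulr_suml.
  rewrite exchange_big; apply: eq_bigr => i _ /=.
  rewrite -sum_enum_val; apply: eq_bigr => j _.
  rewrite !ME !mxE -/A -AE.
  have [qj|qj] := eqVneq (q j) 0.
    by rewrite qj invr0 mul0r !mulr0 -q2 -[_ * q i * _]mulrA q0 // mulr0 !mul0r.
  by rewrite -q2; field.
have normE : (z0 *m z0^T) 0 0 = \sum_i pi i * w i ^+ 2.
  rewrite row_dotE -sum_enum_val; apply: eq_bigr => i _.
  by rewrite !mxE -q2; ring.
have [z00|z0n] := eqVneq z0 0.
  by rewrite -formE -normE z00 !mul0mx mxE mulr0.
have [mu [z [zn zC zM zmax]]] := symmetric_top_eigenvector Msym MC z0n z0C.
rewrite -formE -normE (le_trans (zmax _ z0C)) //.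
apply: ler_wpM2r; first exact/ltW/row_dot_gt0.
have [zq zo] := (CP _).1 zC.
apply: le_second_root.
- exact: eigK.1.
- by rewrite (size_eigenvalues eigK).
- by move=> y /(eigenvalues_norm_le1 eigK); exact/le_trans/ler_norm.
rewrite -eigK.2 -/A -!char_poly_scalar1.
pose p := \row_j pi (enum_val j) : 'rV[R]_#|S|.
pose v := \row_j (q j * z 0 j) : 'rV[R]_#|S|.
rewrite -(char_poly_block_lower _ 0).
have sum_p : \sum_i p 0 i = 1.
  under eq_bigr do rewrite mxE.
  by rewrite sum_enum_val pi_distr.2.
have sum_v : \sum_i v 0 i = 0.
  by rewrite -[RHS]zq; apply: eq_bigr => i _; rewrite mxE mulrC.
have vn : v != 0.
  apply: contra zn => /eqP v0; apply/eqP/rowP => i; rewrite mxE.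
  have /eqP := congr1 (fun M : 'rV[R]_#|S| => M 0 i) v0.
  by rewrite !mxE mulf_eq0 => /orP[/eqP/zo //|/eqP].
(* The rows [p] and [v] span a plane on which [K] acts as diag(1, mu). They are independent because
   the entries of [p] sum to 1, those of the nonzero [v] to 0. *)
apply: (@char_poly_stable_dvd R _ _ (col_mx p v)).
  apply: inj_row_free => u; rewrite -[u]hsubmxK mul_row_col => uV.
  set a := lsubmx u in uV *; set b := rsubmx u in uV *.
  have uVj j : a 0 0 * p 0 j + b 0 0 * v 0 j = 0.
    have := congr1 (fun M : 'rV[R]_#|S| => M 0 j) uV.
    by rewrite /= [LHS]mxE [X in X + _]mxE [X in _ + X]mxE !big_ord1 [RHS]mxE.
  have a0 : a 0 0 = 0.
    have : \sum_j (a 0 0 * p 0 j + b 0 0 * v 0 j) = 0 by rewrite big1.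
    by rewrite big_split /= -!mulr_sumr sum_p sum_v mulr1 mulr0 addr0.
  have b0 : b 0 0 = 0.
    apply/eqP; apply: contraR vn => b0; apply/eqP/rowP => j.
    have /eqP := uVj j; rewrite a0 mul0r add0r mulf_eq0 (negPf b0) /=.
    by move/eqP ->; rewrite mxE.
  have -> : a = 0 by apply/matrixP => i j; rewrite !ord1 a0 mxE.
  have -> : b = 0 by apply/matrixP => i j; rewrite !ord1 b0 mxE.
  by rewrite row_mx0.
rewrite mul_col_mx block_mxEv mul_col_mx !mul_row_col !mul_scalar_mx.
rewrite !mul0mx addr0 add0r scale1r; congr col_mx; apply/rowP => j.
  rewrite !mxE; under eq_bigr do rewrite !mxE.
  by rewrite (sum_enum_val (fun i => pi i * K i _)) stationary.
rewrite mxE; under eq_bigr => i _ do rewrite mxE.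
have [qj|qj] := eqVneq (q j) 0.
  rewrite !mxE qj mul0r mulr0 big1 // => i _.
  by rewrite mulrAC q0 // mul0r.
have := congr1 (fun M : 'rV[R]_#|S| => M 0 j * q j) zM.
rewrite /= [(mu *: z) 0 j]mxE [(z *m M) 0 j]mxE mulr_suml => zMj.
rewrite !mxE (mulrC (q j)) mulrA -zMj; apply: eq_bigr => i _.
by rewrite ME -/A; field.
Qed.

End SpectralGap.

(** * Concentration of chain averages *)

Section Paths.
Variables (R : realType) (S : finType) (K : S -> S -> R).

Definition path_prod m (x : {ffun 'I_m.+1 -> S}) : R :=
  \prod_(j < m) K (x (inord j)) (x (inord j.+1)).

Definition path_cons m (s : S) (y : {ffun 'I_m.+1 -> S}) :
    {ffun 'I_m.+2 -> S} :=
  [ffun i => if unlift ord0 i is Some j then y j else s].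

Lemma path_cons0 m s (y : {ffun 'I_m.+1 -> S}) : path_cons s y ord0 = s.
Proof. by rewrite ffunE unlift_none. Qed.

Lemma path_cons_lift m s (y : {ffun 'I_m.+1 -> S}) j :
  path_cons s y (lift ord0 j) = y j.
Proof. by rewrite ffunE liftK. Qed.

Lemma inordS m j : (j <= m)%N ->
  inord j.+1 = lift ord0 (inord j : 'I_m.+1) :> 'I_m.+2.
Proof. by move=> jm; apply/val_inj; rewrite /= /bump !inordK // ltnS. Qed.

Lemma inord0 m : inord 0 = ord0 :> 'I_m.+1.
Proof. by apply/val_inj; rewrite /= inordK. Qed.

Lemma sum_path0 (F : {ffun 'I_1 -> S} -> R) :
  \sum_x F x = \sum_s F [ffun=> s].
Proof.
rewrite (reindex (fun s : S => [ffun=> s] : {ffun 'I_1 -> S})) //=.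
exists (fun x => x ord0) => x _; first by rewrite ffunE.
by apply/ffunP => i; rewrite ffunE (ord1 i).
Qed.

Lemma sum_pathS m (F : {ffun 'I_m.+2 -> S} -> R) :
  \sum_x F x = \sum_s \sum_y F (path_cons s y).
Proof.
rewrite pair_big /=.
rewrite (reindex (fun p : S * {ffun 'I_m.+1 -> S} => path_cons p.1 p.2)) //=.
exists (fun x => (x ord0, [ffun j => x (lift ord0 j)])) => [[s y] _|x _] /=.
  congr pair; first exact: path_cons0.
  by apply/ffunP => j; rewrite ffunE path_cons_lift.
apply/ffunP => i; rewrite ffunE.
by case: unliftP => [j ->|->]; rewrite ?ffunE.
Qed.

Lemma path_prod_cons m s (y : {ffun 'I_m.+1 -> S}) :
  path_prod (path_cons s y) = K s (y ord0) * path_prod y.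
Proof.
rewrite /path_prod big_ord_recl /= inord0 path_cons0 inordS //.
rewrite path_cons_lift inord0; congr (_ * _); apply: eq_bigr => j _.
by rewrite /bump /= add1n !inordS ?path_cons_lift // ltnW.
Qed.

Hypothesis K_stoch : is_transition_matrix K.

(** Summing out the first state replaces [u] by [u K], which has the same total mass; hence the
    induction is over all [u]. *)
Lemma sum_path_prod m (u : S -> R) :
  \sum_(x : {ffun 'I_m.+1 -> S}) u (x ord0) * path_prod x = \sum_s u s.
Proof.
elim: m u => [|m IH] u.
  rewrite sum_path0; apply: eq_bigr => s _.
  by rewrite ffunE /path_prod big_ord0 mulr1.
rewrite sum_pathS exchange_big /=.
under eq_bigr => y _.
  under eq_bigr => s _ do rewrite path_cons0 path_prod_cons mulrA.
  rewrite -mulr_suml; over.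
rewrite (IH (fun y => \sum_s u s * K s y)) exchange_big; apply: eq_bigr => s _.
by rewrite -mulr_sumr (K_stoch s).2 mulr1.
Qed.

Lemma path_prod_ge0 m (x : {ffun 'I_m.+1 -> S}) : 0 <= path_prod x.
Proof. by apply: prodr_ge0 => j _; exact: (K_stoch _).1. Qed.

End Paths.

(** Meant for a function u with mean [a], where w = u - a has squared norm [W] and [c] is the inner
    product of f and w. The cross term is linear in [theta], but the gap absorbs it at a cost of
    order theta^2 / gamma. *)
Lemma tilted_quadratic_le (R : realFieldType) (gamma theta a c W : R) :
  0 < gamma <= 2 -> 0 <= theta -> 6 * theta <= gamma -> c ^+ 2 <= W ->
  a ^+ 2 + (1 - gamma) * W <= (1 + 2 * theta ^+ 2 / gamma) *
    (a ^+ 2 + (1 - theta) * W - 2 * theta * a * c).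
Proof.
move=> /andP[gamma_gt0 gamma_le2] theta_ge0 theta_le cW.
have [eps epsE] : exists eps, 2 * theta ^+ 2 / gamma = eps by eexists.
rewrite epsE.
have eps0 : 0 <= eps by rewrite -epsE divr_ge0 ?mulr_ge0 ?sqr_ge0 // ltW.
have eps_gamma : eps * gamma = 2 * theta ^+ 2.
  by rewrite -epsE divfK // gt_eqF.
(* This gives (1 + eps)^2 / 2 <= 50/81 < 5/6, the positivity of the completed square below; 5/6 is
   the share of [gamma] left by [theta <= gamma / 6]. *)
have eps_le : 9 * eps <= 1.
  rewrite -(ler_pM2r gamma_gt0) -mulrA eps_gamma expr2.
  have : (6 * theta) * (6 * theta) <= gamma * 2.
    by apply: ler_pM => //; lra.
  lra.
rewrite -subr_ge0.
(* Scaled by [gamma], the difference dominates a positive definite form in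
   [theta * a] and [gamma * c]. *)
have q : 0 <= eps * a ^+ 2 + 5/6 * gamma * c ^+ 2
    - 2 * (1 + eps) * theta * a * c.
  rewrite -(pmulr_lge0 _ gamma_gt0).
  have -> : (eps * a ^+ 2 + 5/6 * gamma * c ^+ 2
      - 2 * (1 + eps) * theta * a * c) * gamma =
      (eps * gamma) * a ^+ 2 + 5/6 * (gamma * c) ^+ 2
      - 2 * (1 + eps) * (theta * a) * (gamma * c) by ring.
  rewrite eps_gamma.
  set X := theta * a; set Y := gamma * c.
  have -> : 2 * theta ^+ 2 * a ^+ 2 = 2 * X ^+ 2 by rewrite /X; ring.
  have -> : 2 * X ^+ 2 + 5/6 * Y ^+ 2 - 2 * (1 + eps) * X * Y =
      2 * (X - (1 + eps) / 2 * Y) ^+ 2 +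
      (5/6 - (1 + eps) ^+ 2 / 2) * Y ^+ 2 by field.
  rewrite addr_ge0 // mulr_ge0 ?sqr_ge0 //.
  have : (1 + eps) * (1 + eps) <= (10/9) * (10/9) by apply: ler_pM; lra.
  by rewrite expr2; lra.
have coef : 5/6 * gamma <= gamma - theta + eps * (1 - theta).
  have : 0 <= eps * (1 - theta) by rewrite mulr_ge0 //; lra.
  by lra.
have : 5/6 * gamma * c ^+ 2 <= (gamma - theta + eps * (1 - theta)) * W.
  by apply: ler_pM; rewrite ?sqr_ge0 //; lra.
have -> : (1 + eps) * (a ^+ 2 + (1 - theta) * W - 2 * theta * a * c) -
   (a ^+ 2 + (1 - gamma) * W) = (gamma - theta + eps * (1 - theta)) * W +
   eps * a ^+ 2 - 2 * (1 + eps) * theta * a * c by ring.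
by lra.
Qed.

(** * Chernoff bound through an exponentially tilted kernel *)

Section Concentration.
Variables (R : realType) (S : finType) (pi : S -> R) (K : S -> S -> R).
Hypotheses (pi_distr : is_distribution pi) (K_stoch : is_transition_matrix K).
Hypothesis K_rev : reversible pi K.

Definition path_weight m (x : {ffun 'I_m.+1 -> S}) : R :=
  pi (x ord0) * path_prod K x.

Lemma path_weight_distr m : is_distribution (@path_weight m).
Proof.
split => [x|]; last by rewrite sum_path_prod // pi_distr.2.
by rewrite mulr_ge0 ?path_prod_ge0 // pi_distr.1.
Qed.

(** By stationarity, summing out the first state of a path leaves the weight of the shorter path. *)
Lemma path_weight_marginal m (h : S -> R) (j : 'I_m.+1) :
  \sum_x path_weight x * h (x j) = \sum_s pi s * h s.
Proof.
elim: m j => [|m IH] j.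
  rewrite sum_path0; apply: eq_bigr => s _.
  by rewrite /path_weight /path_prod big_ord0 !ffunE mulr1.
case: (unliftP ord0 j) => [k ->|->].
  rewrite sum_pathS exchange_big -(IH k); apply: eq_bigr => y _ /=.
  rewrite /path_weight -(stationary K_stoch K_rev) !mulr_suml.
  apply: eq_bigr => s _.
  by rewrite path_cons0 path_prod_cons path_cons_lift mulrA.
rewrite -(sum_path_prod K_stoch m.+1 (fun s => pi s * h s)).
by apply: eq_bigr => x _; rewrite /path_weight mulrAC.
Qed.

Definition form (u v : S -> R) : R := \sum_i \sum_j pi i * K i j * u i * v j.

Lemma formC u v : form u v = form v u.
Proof.
rewrite /form exchange_big; apply: eq_bigr => i _; apply: eq_bigr => j _.
by rewrite K_rev; ring.
Qed.

Lemma formDB u v :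
  form (fun i => u i + v i) (fun i => u i + v i) -
  form (fun i => u i - v i) (fun i => u i - v i) = 4 * form u v.
Proof.
rewrite (_ : 4 * _ = 2 * form u v + 2 * form v u); last first.
  by rewrite (formC v); ring.
rewrite /form !mulr_sumr -sumrB -big_split; apply: eq_bigr => i _ /=.
rewrite !mulr_sumr -sumrB -big_split; apply: eq_bigr => j _ /=; ring.
Qed.

Section Tilted.
Variables (d : S -> R) (rho : R).
Hypotheses (d_gt0 : forall i, 0 < d i) (rho_gt0 : 0 < rho).
Hypothesis form_le :
  forall u, form u u <= rho * \sum_i pi i * (u i ^+ 2 / d i).

Definition tilt (w : S -> R) (i : S) : R := \sum_j K i j * (d j * w j).

(* [K] has nonnegative entries, so replacing [u] by [|u|] bounds the form from
   below as well; the polarization identity then gives the operator norm. *)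
Lemma tilt_contraction w :
  \sum_i pi i * (d i * tilt w i ^+ 2) <=
  rho ^+ 2 * \sum_i pi i * (d i * w i ^+ 2).
Proof.
have form_ge u : - form u u <= rho * \sum_i pi i * (u i ^+ 2 / d i).
  have := form_le (fun i => `|u i|).
  under [in leRHS]eq_bigr do rewrite real_normK ?num_real //.
  apply: le_trans.
  rewrite -sumrN; apply: ler_sum => i _; rewrite -sumrN; apply: ler_sum => j _.
  have pK : 0 <= pi i * K i j by rewrite mulr_ge0 ?pi_distr.1 ?(K_stoch i).1.
  have -> : pi i * K i j * `|u i| * `|u j| = pi i * K i j * `|- (u i * u j)|.
    by rewrite normrN normrM mulrA.
  by rewrite -[_ * u j]mulrA -mulrN ler_wpM2l ?ler_norm.
set N := \sum_i _; set W := \sum_i _.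
pose u i := d i * w i; pose v i := d i * tilt w i / rho.
have dn i : d i != 0 by rewrite gt_eqF.
have rn : rho != 0 by rewrite gt_eqF.
have vu : form v u = N / rho.
  rewrite /form /N mulr_suml; apply: eq_bigr => i _.
  transitivity (\sum_j pi i * v i * (K i j * u j)).
    by apply: eq_bigr => j _; ring.
  by rewrite -mulr_sumr -/(tilt w i) /v; field.
have := lerD (form_le (fun i => u i + v i)) (form_ge (fun i => u i - v i)).
rewrite formDB formC vu -mulrDr -big_split /=.
have -> : \sum_i (pi i * ((u i + v i) ^+ 2 / d i) +
    pi i * ((u i - v i) ^+ 2 / d i)) = 2 * W + 2 * (N / rho ^+ 2).
  rewrite /W /N mulr_suml !mulr_sumr -big_split; apply: eq_bigr => i _ /=.
  by rewrite /u /v; field; rewrite dn rn.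
have -> : rho * (2 * W + 2 * (N / rho ^+ 2)) = 2 * rho * W + 2 * (N / rho).
  by field.
move=> h; have -> : rho ^+ 2 * W = rho * W * rho by ring.
by rewrite -ler_pdivrMr //; lra.
Qed.

Lemma tilt_iter k :
  \sum_i pi i * (d i * iter k tilt (fun=> 1) i ^+ 2) <=
  (rho ^+ k) ^+ 2 * \sum_i pi i * d i.
Proof.
elim: k => [|k IH].
  rewrite expr0 expr1n mul1r; apply: ler_sum => i _.
  by rewrite mulr1.
rewrite iterS (le_trans (tilt_contraction _)) // (exprS rho k) exprMn.
by rewrite -[leRHS]mulrA ler_pM2l // exprn_gt0.
Qed.

(** The initial factor [w] drives the induction: reversibility turns the sum over the first state
    into one application of [tilt], so the path loses a state and [w] becomes [tilt w]. *)
Lemma path_mgf_iter m w :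
  \sum_(x : {ffun 'I_m.+1 -> S})
     pi (x ord0) * w (x ord0) * path_prod K x * \prod_i d (x i) =
  \sum_i pi i * (d i * iter m tilt w i).
Proof.
elim: m w => [|m IH] w.
  rewrite sum_path0; apply: eq_bigr => s _.
  by rewrite /path_prod big_ord0 big_ord1 !ffunE /=; ring.
rewrite iterSr -IH sum_pathS exchange_big; apply: eq_bigr => y _ /=.
rewrite /tilt mulr_sumr !mulr_suml; apply: eq_bigr => s _.
rewrite path_cons0 path_prod_cons big_ord_recl path_cons0.
have -> : \prod_i d (path_cons s y (lift ord0 i)) = \prod_i d (y i).
  by apply: eq_bigr => i _; rewrite path_cons_lift.
set D := \prod_i _.
transitivity (pi s * K s (y ord0) * (w s * path_prod K y * (d s * D))).
  by ring.
by rewrite K_rev; ring.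
Qed.

Lemma path_mgf_le m :
  \sum_(x : {ffun 'I_m.+1 -> S}) path_weight x * \prod_i d (x i) <=
  rho ^+ m * \sum_i pi i * d i.
Proof.
have -> : \sum_(x : {ffun 'I_m.+1 -> S}) path_weight x * \prod_i d (x i) =
    \sum_i pi i * (d i * iter m tilt (fun=> 1) i).
  by rewrite -path_mgf_iter; apply: eq_bigr => x _; rewrite mulr1.
set c := rho ^+ m; set D := \sum_i pi i * d i.
have c_gt0 : 0 < c by rewrite exprn_gt0.
have := tilt_iter m; rewrite -/c -/D; set W := iter m _ _ => W2.
(* Cauchy-Schwarz against the constant 1, in the form 2 c W <= W^2 + c^2 weighted by
   [pi i * d i]. *)
have : 2 * c * (\sum_i pi i * (d i * W i)) <=
    \sum_i pi i * (d i * W i ^+ 2) + c ^+ 2 * D.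
  rewrite !mulr_sumr -big_split; apply: ler_sum => i _ /=.
  have : 0 <= pi i * d i * (W i - c) ^+ 2.
    by rewrite mulr_ge0 ?sqr_ge0 // mulr_ge0 ?pi_distr.1 // ltW.
  rewrite -subr_ge0 => h; rewrite -subr_ge0; apply: le_trans h _.
  by rewrite le_eqVlt; apply/orP; left; apply/eqP; ring.
move=> h; rewrite -(ler_pM2l c_gt0) mulrA -expr2.
have := le_trans h (lerD W2 (lexx _)); lra.
Qed.

End Tilted.

Section Tail.
Variables (gamma theta : R) (f : S -> R).
Hypothesis gap : forall w : S -> R, \sum_i pi i * w i = 0 ->
  form w w <= (1 - gamma) * \sum_i pi i * w i ^+ 2.
Hypotheses (gamma_gt0 : 0 < gamma) (gamma_le2 : gamma <= 2).
Hypotheses (theta_ge0 : 0 <= theta) (theta_le : 6 * theta <= gamma).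
Hypotheses (f_le1 : forall i, `|f i| <= 1) (f_mean0 : \sum_i pi i * f i = 0).

(** Constants are fixed by [K], which is self-adjoint, so the cross terms are multiples of the mean
    of [w]. *)
Lemma form_shift (a : R) w : \sum_i pi i * w i = 0 ->
  form (fun i => a + w i) (fun i => a + w i) = a ^+ 2 + form w w.
Proof.
move=> w0.
have rowK i b : \sum_j K i j * b = b by rewrite -mulr_suml (K_stoch i).2 mul1r.
have e1 : form (fun=> a) (fun i => a + w i) = a ^+ 2.
  rewrite formC /form.
  transitivity (\sum_i pi i * (a + w i) * \sum_j K i j * a).
    by apply: eq_bigr => i _; rewrite mulr_sumr; apply: eq_bigr => j _; ring.
  under eq_bigr do rewrite rowK.
  rewrite -mulr_suml; under eq_bigr do rewrite mulrDr.
  by rewrite big_split /= w0 -mulr_suml pi_distr.2 addr0 mul1r expr2.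
have e2 : form w (fun=> a) = 0.
  transitivity (\sum_i pi i * w i * a); last by rewrite -mulr_suml w0 mul0r.
  rewrite /form; apply: eq_bigr => i _.
  rewrite -[RHS]mulr1 -(K_stoch i).2 mulr_sumr; apply: eq_bigr => j _; ring.
rewrite -e1 -[form w w]add0r -e2 /form -!big_split; apply: eq_bigr => i _ /=.
rewrite -!big_split; apply: eq_bigr => j _ /=; ring.
Qed.

(** Split u = a + w with [a] the mean of [u]. The gap bounds the left side; on the right, exp(-x) >=
    1 - x makes the weight affine in [f], and |f| <= 1 bounds the term in f w^2. *)
Lemma form_tilted_le u :
  form u u <= (1 + 2 * theta ^+ 2 / gamma) *
    \sum_i pi i * (u i ^+ 2 / expR (theta * f i)).
Proof.
set eps := 2 * theta ^+ 2 / gamma.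
have [a aE] : exists a, \sum_i pi i * u i = a by eexists.
pose w i := u i - a.
have w0 : \sum_i pi i * w i = 0.
  under eq_bigr do rewrite mulrBr.
  rewrite sumrB aE -mulr_suml pi_distr.2 mul1r subrr //.
pose W := \sum_i pi i * w i ^+ 2.
have [c cE] : exists c, \sum_i pi i * (f i * w i) = c by eexists.
have pi0 := pi_distr.1.
have f2 : \sum_i pi i * f i ^+ 2 <= 1.
  rewrite -[leRHS]pi_distr.2; apply: ler_sum => i _.
  by rewrite ler_piMr // -real_normK ?num_real // expr_le1.
have cW : c ^+ 2 <= W.
  (* Cauchy-Schwarz: since f^2 has mean at most 1, expanding gives W - 2 c^2 + c^2 >= 0. *)
  have : 0 <= \sum_i pi i * (w i - c * f i) ^+ 2.
    by apply: sumr_ge0 => i _; rewrite mulr_ge0 ?sqr_ge0.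
  have -> : \sum_i pi i * (w i - c * f i) ^+ 2 =
      W - 2 * c * (\sum_i pi i * (f i * w i)) +
      c ^+ 2 * \sum_i pi i * f i ^+ 2.
    rewrite /W !mulr_sumr -sumrB -big_split; apply: eq_bigr => i _ /=.
    by ring.
  have : c ^+ 2 * (\sum_i pi i * f i ^+ 2) <= c ^+ 2.
    by rewrite ler_piMr ?sqr_ge0.
  by rewrite cE !expr2; lra.
have lhs : form u u <= a ^+ 2 + (1 - gamma) * W.
  have -> : form u u = a ^+ 2 + form w w.
    rewrite -form_shift //; congr form; apply/funext => i; rewrite /w; ring.
  by rewrite lerD2l; exact: gap.
have rhs : a ^+ 2 + (1 - theta) * W - 2 * theta * a * c <=
    \sum_i pi i * (u i ^+ 2 / expR (theta * f i)).
  have : \sum_i pi i * ((1 - theta * f i) * u i ^+ 2) <=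
      \sum_i pi i * (u i ^+ 2 / expR (theta * f i)).
    apply: ler_sum => i _; rewrite ler_wpM2l // mulrC ler_wpM2l ?sqr_ge0 //.
    by rewrite -expRN -mulNr (le_trans _ (expR_ge1Dx _)) // mulNr.
  apply: le_trans.
  have -> : \sum_i pi i * ((1 - theta * f i) * u i ^+ 2) = a ^+ 2 + W
      - 2 * theta * a * c - theta * \sum_i pi i * (f i * w i ^+ 2).
    transitivity ((a ^+ 2 * \sum_i pi i) + W + 2 * a * (\sum_i pi i * w i)
      - 2 * theta * a * (\sum_i pi i * (f i * w i))
      - theta * \sum_i pi i * (f i * w i ^+ 2)
      - theta * a ^+ 2 * \sum_i pi i * f i).
      rewrite /W !mulr_sumr -!(sumrB, big_split); apply: eq_bigr => i _ /=.
      by rewrite /w; ring.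
    by rewrite pi_distr.2 w0 f_mean0 cE; ring.
  have : theta * (\sum_i pi i * (f i * w i ^+ 2)) <= theta * W.
    rewrite ler_wpM2l //; apply: ler_sum => i _; rewrite ler_wpM2l //.
    by rewrite ler_piMl ?sqr_ge0 // (le_trans (ler_norm _)).
  by lra.
have eps0 : 0 <= eps by rewrite divr_ge0 ?mulr_ge0 ?sqr_ge0 // ltW.
apply: le_trans lhs _.
apply: le_trans (ler_wpM2l (addr_ge0 ler01 eps0) rhs).
by apply: tilted_quadratic_le => //; rewrite gamma_gt0.
Qed.

(** Markov's inequality for the exponential of [theta] times the sum. A path has m + 1 states but m
    transitions: the m factors 1 + 2 theta^2 / gamma come from the operator norm, and the extra
    exp(theta) bounds the mean of [d]. *)
Lemma path_tail m (delta : R) :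
  \sum_(x : {ffun 'I_m.+1 -> S} | delta <= (\sum_i f (x i)) / m.+1%:R)
    path_weight x <=
  expR (theta - theta * m.+1%:R * delta + 2 * theta ^+ 2 / gamma * m%:R).
Proof.
set eps := 2 * theta ^+ 2 / gamma.
have eps0 : 0 <= eps by rewrite divr_ge0 ?mulr_ge0 ?sqr_ge0 // ltW.
pose d i := expR (theta * f i).
have mgf := @path_mgf_le d (1 + eps) (fun=> expR_gt0 _)
  (ltr_wpDr eps0 ltr01) form_tilted_le m.
have dE : \sum_i pi i * d i <= expR theta.
  rewrite -[leRHS]mul1r -pi_distr.2 mulr_suml; apply: ler_sum => i _.
  rewrite ler_wpM2l ?pi_distr.1 // ler_expR -[leRHS]mulr1 ler_wpM2l //.
  exact: le_trans (ler_norm _) (f_le1 i).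
have epsE : (1 + eps) ^+ m <= expR (eps * m%:R).
  by rewrite expRM_natr lerXn2r ?nnegrE ?expR_ge0 ?expR_ge1Dx // addr_ge0.
rewrite 2!expRD (mulrC (expR theta)) -[leRHS]mulrA expRN.
rewrite ler_pdivlMl ?expR_gt0 //.
rewrite mulr_sumr.
apply: le_trans (_ : _ <= (1 + eps) ^+ m * \sum_i pi i * d i) _;
  last first.
  rewrite mulrC; apply: ler_pM => //.
    by apply: sumr_ge0 => i _; rewrite mulr_ge0 ?pi_distr.1 ?expR_ge0.
  by rewrite exprn_ge0 // addr_ge0.
apply: le_trans mgf; rewrite [leRHS](bigID
  (fun x : {ffun 'I_m.+1 -> S} => delta <= (\sum_i f (x i)) / m.+1%:R)) /=.
rewrite -[leLHS]addr0 lerD //; last first.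
  apply: sumr_ge0 => x _; rewrite mulr_ge0 ?(path_weight_distr m).1 //.
  by apply: prodr_ge0 => i _; exact: expR_ge0.
apply: ler_sum => x; rewrite ler_pdivlMr ?ltr0n // => fx.
rewrite mulrC ler_wpM2l ?(path_weight_distr m).1 // /d -expR_sum ler_expR.
by rewrite -mulr_sumr -mulrA ler_wpM2l // mulrC.
Qed.

End Tail.
End Concentration.

(** * Clamped means of independent samples *)

Section Statistic.
Variables (R : realType) (I : finType) (D : pred I).
Implicit Type a : I -> R.

(* The averages lie in [0, 1], so the neutral elements 1 and 0 are harmless. *)
Definition pilot_min a : R := \big[Num.min/1]_(r | D r) a r.
Definition pilot_max a : R := \big[Num.max/0]_(r | D r) a r.
Definition clamp (l h x : R) : R := Num.max l (Num.min h x).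
Definition clamped_sum a : R :=
  \sum_(r | ~~ D r) clamp (pilot_min a) (pilot_max a) (a r).

Lemma pilot_min_le a r : D r -> pilot_min a <= a r.
Proof. exact: bigmin_le_cond. Qed.

Lemma le_pilot_max a r : D r -> a r <= pilot_max a.
Proof. exact: le_bigmax_cond. Qed.

Lemma pilot_min_max a r : D r -> pilot_min a <= pilot_max a.
Proof.
by move=> Dr; apply: le_trans (pilot_min_le a Dr) (le_pilot_max a Dr).
Qed.

Lemma clamp_bounds l h x : l <= h -> l <= clamp l h x <= h.
Proof. by move=> lh; rewrite le_max lexx /= ge_max lh ge_min lexx. Qed.

End Statistic.

(** * Product space of independent samples *)

Section Sampling.
Variables (R : realType) (V : finType) (p : V -> R) (I : finType).
Hypothesis p_distr : is_distribution p.
Implicit Types (om : {ffun I -> V}) (F : {ffun I -> V} -> R).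

Definition sample_weight om : R := \prod_r p (om r).
Definition expect F : R := \sum_om sample_weight om * F om.

Lemma expect_prod (h : I -> V -> R) :
  expect (fun om => \prod_r h r (om r)) = \prod_r \sum_x p x * h r x.
Proof.
by rewrite bigA_distr_bigA; apply: eq_bigr => om _; rewrite -big_split.
Qed.

Lemma sample_weight_distr : is_distribution sample_weight.
Proof.
split=> [om|]; first by apply: prodr_ge0 => r _; exact: p_distr.1.
transitivity (expect (fun om => \prod_(r : I) 1)).
  by apply: eq_bigr => om _; rewrite big1_eq mulr1.
rewrite (expect_prod (fun _ _ => 1)) big1 // => r _.
by under eq_bigr do rewrite mulr1; exact: p_distr.2.
Qed.

Lemma expect_cst c : expect (fun=> c) = c.
Proof. by rewrite /expect -mulr_suml sample_weight_distr.2 mul1r. Qed.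

Lemma ler_expect F G : (forall om, F om <= G om) -> expect F <= expect G.
Proof.
move=> FG; apply: ler_sum => om _.
by rewrite ler_wpM2l ?sample_weight_distr.1.
Qed.

Lemma expectD F G : expect (fun om => F om + G om) = expect F + expect G.
Proof. by rewrite -big_split; apply: eq_bigr => om _; rewrite mulrDr. Qed.

Lemma expect_sum (J : finType) (P : pred J) (F : J -> {ffun I -> V} -> R) :
  expect (fun om => \sum_(j | P j) F j om) = \sum_(j | P j) expect (F j).
Proof.
by rewrite exchange_big; apply: eq_bigr => om _; rewrite mulr_sumr.
Qed.

Definition resample om r x : {ffun I -> V} :=
  [ffun i => if i == r then x else om i].

Lemma resample_same om r x : resample om r x r = x.
Proof. by rewrite ffunE eqxx. Qed.

Lemma resample_other om r x i : i != r -> resample om r x i = om i.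
Proof. by rewrite ffunE => /negPf ->. Qed.

(* [(om, x) |-> (resample om r x, om r)] is an involution preserving the
   product weight. *)
Lemma expect_resample F r :
  expect F = expect (fun om => \sum_x p x * F (resample om r x)).
Proof.
transitivity (\sum_om \sum_x sample_weight om * p x * F om).
  apply: eq_bigr => om _; rewrite -mulr_suml -mulr_sumr p_distr.2 mulr1 //.
rewrite pair_big /=.
pose swap (q : {ffun I -> V} * V) := (resample q.1 r q.2, q.1 r).
have swapK : cancel swap swap.
  move=> [om x]; rewrite /swap /= resample_same; congr pair.
  by apply/ffunP => i; rewrite !ffunE; case: eqP => [->|].
rewrite (reindex swap) /=; last by exists swap => q _; exact: swapK.
transitivity (\sum_om \sum_x sample_weight om * p x * F (resample om r x)).
  rewrite pair_big /=; apply: eq_bigr => -[om x] _ /=; congr (_ * _).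
  rewrite /sample_weight (bigD1 r) //= [in RHS](bigD1 r) //= resample_same.
  under eq_bigr => i ir do rewrite resample_other //.
  by ring.
apply: eq_bigr => om _; rewrite mulr_sumr; apply: eq_bigr => x _.
by rewrite mulrA.
Qed.

Lemma expect_marginal (h : V -> R) r :
  expect (fun om => h (om r)) = \sum_x p x * h x.
Proof.
rewrite (expect_resample _ r) -[RHS]expect_cst; apply: eq_bigr => om _.
by congr (_ * _); apply: eq_bigr => x _; rewrite resample_same.
Qed.

Variable D : pred I.

(** The function [phi om] depends on the pilot coordinates only, so resampling a coordinate outside
    [D] amounts to conditioning on the pilots: cross terms vanish by centering and diagonal terms
    are conditional variances. *)
Lemma expect_sqr_sum (phi : {ffun I -> V} -> V -> R) (B : R) :
  (forall om r x, ~~ D r -> phi (resample om r x) = phi om) ->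
  (forall om, \sum_x p x * phi om x = 0) ->
  (forall om, \sum_x p x * phi om x ^+ 2 <= B) ->
  expect (fun om => (\sum_(r | ~~ D r) phi om (om r)) ^+ 2) <=
  #|predC D|%:R * B.
Proof.
move=> phiD phi0 phiB.
have -> : (fun om => (\sum_(r | ~~ D r) phi om (om r)) ^+ 2) = fun om =>
    \sum_(r | ~~ D r) \sum_(s | ~~ D s) phi om (om r) * phi om (om s).
  by apply/funext => om; rewrite expr2 big_distrlr.
rewrite expect_sum mulr_natl -sumr_const.
apply: ler_sum => r Dr; rewrite expect_sum (bigD1 r) //= big1 ?addr0.
  rewrite (expect_resample _ r) -[leRHS]expect_cst; apply: ler_expect => om.
  apply: le_trans (phiB om); rewrite le_eqVlt; apply/orP; left; apply/eqP.
  by apply: eq_bigr => x _; rewrite phiD // resample_same expr2.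
move=> s /andP[_ sr].
rewrite (expect_resample _ r) -[RHS]expect_cst; apply: eq_bigr => om _.
congr (_ * _).
transitivity (\sum_x p x * phi om x * phi om (om s)).
  apply: eq_bigr => x _; rewrite phiD // resample_same resample_other //.
  by rewrite mulrA.
by rewrite -mulr_suml phi0 mul0r.
Qed.

Definition mass_below (s : V -> R) (t : R) : R := \sum_(x | s x < t) p x.

(** A point of least score in the set has mass more than [y] strictly below it, all of it outside
    the set by minimality. The set thus has mass less than 1 - y <= exp(-y). *)
Lemma upper_set_mass (s : V -> R) (y : R) :
  \sum_(x | y < mass_below s (s x)) p x <= expR (- y).
Proof.
pose U x := y < mass_below s (s x).
have [x0 Ux0|U0] := pickP U; last by rewrite big_pred0 // expR_ge0.
pose xm := [arg min_(x < x0 | U x) s x]%O.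
have [Uxm xmin] : U xm /\ forall x, U x -> s xm <= s x.
  by rewrite /xm; case: arg_minP => // x Ux h; split.
apply: le_trans (expR_ge1Dx (- y)).
rewrite -p_distr.2 [in leRHS](bigID U) /= -addrA lerDl subr_ge0.
apply: le_trans (ltW Uxm) _; rewrite /mass_below big_mkcond [leRHS]big_mkcond.
apply: ler_sum => x _; case: ifPn => [xxm|_].
  by case: ifPn => // /negbNE /xmin; rewrite leNgt xxm.
by case: ifP => // _; exact: p_distr.1.
Qed.

(** Independence raises the bound of [upper_set_mass] to the number of pilots. The scores [v] and
    [- v] serve the two ends of the range. *)
Lemma expect_pilot_extreme (s : V -> R) (y : R) :
  expect (fun om => [forall (r | D r), (y < mass_below s (s (om r)))%R]%:R) <=
  expR (- (#|D|%:R * y)).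
Proof.
pose h r x : R := if D r then (y < mass_below s (s x))%R%:R else 1.
apply: (@le_trans _ _ (expect (fun om => \prod_r h r (om r)))).
  apply: ler_expect => om.
  have h0 r : 0 <= h r (om r) by rewrite /h; case: ifP.
  case: forallP => [yP|_]; last by rewrite prodr_ge0.
  rewrite big1 // => r _; rewrite /h; case: ifP => // Dr.
  by have := yP r; rewrite Dr /= => ->.
rewrite expect_prod; set q := \sum_(x | y < mass_below s (s x)) p x.
have -> : \prod_r \sum_x p x * h r x = q ^+ #|D|.
  rewrite -prodr_const [RHS]big_mkcond /=; apply: eq_bigr => r _.
  rewrite -topredE /= /h; case: ifP => Dr.
    rewrite /q [RHS]big_mkcond; apply: eq_bigr => x _.
    by case: ifP; rewrite ?mulr1 ?mulr0.
  by under eq_bigr do rewrite mulr1; exact: p_distr.2.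
rewrite -mulrN mulrC expRM_natr lerXn2r ?nnegrE ?expR_ge0 ?upper_set_mass //.
by apply: sumr_ge0 => x _; exact: p_distr.1.
Qed.

Variables (v : V -> R) (n : nat) (alpha : R).
Hypotheses (v01 : forall x, 0 <= v x <= 1) (n_gt0 : (0 < n)%N).
Hypotheses (cardD : #|D| = n) (cardDC : #|predC D| = n).
Hypothesis alpha_gt0 : 0 < alpha.

Let mean : R := \sum_x p x * v x.
Let lo om := pilot_min D (v \o om).
Let hi om := pilot_max D (v \o om).
Let clamped_mean l h : R := \sum_x p x * clamp l h (v x).

Lemma pilot_nonempty : exists r, D r.
Proof.
by move: n_gt0; rewrite -cardD => /card_gt0P[r Dr]; exists r.
Qed.

Lemma pilot_max_ge0 om : 0 <= hi om.
Proof.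
have [r Dr] := pilot_nonempty.
apply: le_trans (le_pilot_max (v \o om) Dr).
by have /andP[] := v01 (om r).
Qed.

(** Clamping raises only values below [l], each by at most 1. Allowing any [t] above [l] lets [t] be
    a pilot value with little mass below it, not necessarily the minimum. *)
Lemma clamped_mean_le l h t : l <= 1 -> l <= t ->
  clamped_mean l h <= mean + mass_below v t.
Proof.
move=> l1 lt; rewrite /mass_below [X in _ + X]big_mkcond -big_split /=.
apply: ler_sum => x _; have /andP[v0 _] := v01 x.
have -> : p x * v x + (if v x < t then p x else 0) =
    p x * (v x + (v x < t)%R%:R) by case: ifP => _ /=; ring.
rewrite ler_wpM2l ?p_distr.1 // ge_max ge_min lerDl ler0n orbT andbT.
have [vt|tv] := ltP (v x) t; first by rewrite -[leLHS]add0r lerD.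
by rewrite addr0 (le_trans lt).
Qed.

Lemma le_clamped_mean l h t : 0 <= h -> t <= h ->
  mean - mass_below (fun x => - v x) (- t) <= clamped_mean l h.
Proof.
move=> h0 th; rewrite lerBlDr /mass_below [X in _ + X]big_mkcond -big_split /=.
apply: ler_sum => x _; have /andP[v0 v1] := v01 x.
have -> : p x * clamp l h (v x) + (if - v x < - t then p x else 0) =
    p x * (clamp l h (v x) + (t < v x)%R%:R).
  by rewrite ltrN2; case: ifP => _ /=; ring.
rewrite ler_wpM2l ?p_distr.1 //.
have [tv|vt] := ltP t (v x).
  by rewrite -[leLHS]add0r lerD // /clamp le_max le_min h0 v0 orbT.
by rewrite addr0 /clamp le_max le_min lexx (le_trans vt th) orbT.
Qed.

(* Popoviciu: the variance is at most the second moment about the midpoint. *)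
Lemma clamped_variance_le l h : l <= h ->
  \sum_x p x * (clamp l h (v x) - clamped_mean l h) ^+ 2 <= (h - l) ^+ 2 / 4.
Proof.
move=> lh; pose mid := (l + h) / 2.
have [c cE] : exists c, clamped_mean l h = c by eexists.
apply: (@le_trans _ _ (\sum_x p x * (clamp l h (v x) - mid) ^+ 2)); last first.
  have -> : (h - l) ^+ 2 / 4 = \sum_x p x * ((h - l) / 2) ^+ 2.
    by rewrite -mulr_suml p_distr.2; field.
  apply: ler_sum => x _; rewrite ler_wpM2l ?p_distr.1 //.
  have /andP[lc ch] := clamp_bounds (v x) lh.
  rewrite -ler_sqrt ?sqr_ge0 // !sqrtr_sqr [leRHS]ger0_norm; last by lra.
  by rewrite ler_norml /mid; apply/andP; split; lra.
rewrite cE -subr_ge0.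
suff -> : \sum_x p x * (clamp l h (v x) - mid) ^+ 2 -
    \sum_x p x * (clamp l h (v x) - c) ^+ 2 = (c - mid) ^+ 2 by exact: sqr_ge0.
transitivity (2 * (c - mid) * clamped_mean l h
    - (c ^+ 2 - mid ^+ 2) * \sum_x p x).
  rewrite -sumrB /clamped_mean !mulr_sumr -sumrB; apply: eq_bigr => x _; ring.
by rewrite p_distr.2 cE; ring.
Qed.

Lemma pilot_min_max_sample om : lo om <= hi om.
Proof. by have [r Dr] := pilot_nonempty; exact: pilot_min_max Dr. Qed.

Lemma pilot_resample om r x : ~~ D r ->
  lo (resample om r x) = lo om /\ hi (resample om r x) = hi om.
Proof.
move=> Dr; have eqv i : D i -> (v \o resample om r x) i = (v \o om) i.
  by move=> Di /=; rewrite resample_other //; apply: contra Dr => /eqP <-.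
by split; apply: eq_bigr.
Qed.

Definition half_width (range : R) : R :=
  ln (4 / alpha) / n%:R + range * (Num.sqrt (2 / alpha) / (2 * Num.sqrt n%:R)).

Lemma coverage :
  expect (fun om => (~~ (`|clamped_sum D (v \o om) / n%:R - mean| <=
    half_width (hi om - lo om)))%:R) <= alpha.
Proof.
pose y := ln (4 / alpha) / n%:R.
pose k := Num.sqrt (2 / alpha) / (2 * Num.sqrt n%:R).
(* Chebyshev threshold for the clamped sum. For a degenerate range it is 0, and division by it makes
   [phi] vanish. *)
pose sd om := (hi om - lo om) * k * n%:R.
pose phi om x := (clamp (lo om) (hi om) (v x) - clamped_mean (lo om) (hi om))
  / sd om.
have nR : 0 < n%:R :> R by rewrite ltr0n.
have k_gt0 : 0 < k by rewrite divr_gt0 ?mulr_gt0 // sqrtr_gt0 ?divr_gt0.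
(* This fixes [k]: the variance bound range^2 / 4 divided by sd^2 is alpha / (2 n) per term, so
   alpha / 2 for the n terms. *)
have k2 : (k * n%:R) ^+ 2 = n%:R / (2 * alpha).
  have sn : Num.sqrt n%:R != 0 :> R by rewrite gt_eqF // sqrtr_gt0.
  have := sqr_sqrtr (ltW nR); rewrite /k !exprMn exprVn exprMn => ->.
  by rewrite sqr_sqrtr ?divr_ge0 // ?ltW //; field; rewrite !gt_eqF.
(* Each end of the pilot range is allowed a failure probability of alpha / 4. *)
have quantile : expR (- (#|D|%:R * y)) = alpha / 4.
  rewrite cardD /y mulrC divfK ?gt_eqF // -lnV ?posrE ?divr_gt0 //.
  by rewrite lnK ?posrE ?invr_gt0 ?divr_gt0 // invf_div.
pose chebyshev om := (\sum_(r | ~~ D r) phi om (om r)) ^+ 2.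
have cheb : expect chebyshev <= alpha / 2.
  apply: le_trans (@expect_sqr_sum phi (alpha / (2 * n%:R)) _ _ _) _.
  - move=> om r x Dr; have [lE hE] := pilot_resample om x Dr.
    by rewrite /phi /sd lE hE.
  - move=> om; rewrite /phi; under eq_bigr do rewrite mulrA.
    rewrite -mulr_suml; under eq_bigr do rewrite mulrBr.
    by rewrite sumrB -[in X in _ - X]mulr_suml p_distr.2 mul1r subrr mul0r.
  - move=> om; under eq_bigr do rewrite /phi expr_div_n mulrA.
    rewrite -mulr_suml; have := clamped_variance_le (pilot_min_max_sample om).
    rewrite /sd -mulrA exprMn k2.
    have [->|hl] := eqVneq (hi om - lo om) 0.
      rewrite expr0n /= !mul0r invr0 mulr0 => _.
      by rewrite divr_ge0 ?mulr_ge0 // ltW.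
    have hl2 : 0 < (hi om - lo om) ^+ 2 by rewrite lt_def sqrf_eq0 hl sqr_ge0.
    rewrite ler_pdivrMr; last by rewrite mulr_gt0 // divr_gt0 ?mulr_gt0.
    move=> /le_trans; apply; rewrite le_eqVlt; apply/orP; left; apply/eqP.
    by field; rewrite !gt_eqF.
  by rewrite cardDC le_eqVlt; apply/orP; left; apply/eqP; field; rewrite gt_eqF.
(* Union bound on indicators: every pilot has too much mass below it, every pilot has too much above
   it, or the rescaled sum is at least 1 in absolute value. *)
apply: (@le_trans _ _ (expect (fun om =>
    ([forall (r | D r), (y < mass_below v (v (om r)))%R]%:R +
     [forall (r | D r), (y < mass_below (fun x => - v x) (- v (om r)))%R]%:R) +
    chebyshev om))); last first.
  rewrite 2!expectD.
  have := expect_pilot_extreme v y.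
  have := expect_pilot_extreme (fun x => - v x) y.
  by rewrite quantile; lra.
apply: ler_expect => om.
have cheb0 : 0 <= chebyshev om by exact: sqr_ge0.
have [_|/forallPn[r]] :=
  boolP [forall (r | D r), (y < mass_below v (v (om r)))%R].
  case: (~~ _); rewrite ?lerDl; last by rewrite !addr_ge0.
  by rewrite -addrA lerDl addr_ge0.
rewrite negb_imply -leNgt => /andP[Dr low].
have [_|/forallPn[s]] := boolP
  [forall (r | D r), (y < mass_below (fun x => - v x) (- v (om r)))%R].
  case: (~~ _); last by rewrite !addr_ge0.
  by rewrite add0r lerDl.
rewrite negb_imply -leNgt => /andP[Ds high].
rewrite /= !add0r; case: (leP _ (half_width _)) => //= far.
have lo1 : lo om <= 1.
  by apply: le_trans (pilot_min_le (v \o om) Dr) _; have /andP[] := v01 (om r).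
have := clamped_mean_le (hi om) lo1 (pilot_min_le (v \o om) Dr).
have := le_clamped_mean (lo om) (pilot_max_ge0 om) (le_pilot_max (v \o om) Ds).
rewrite /=; set c := clamped_mean _ _ => c_ge c_le.
have devE : \sum_(r | ~~ D r) phi om (om r) =
    (clamped_sum D (v \o om) - n%:R * c) / sd om.
  rewrite -mulr_suml sumrB sumr_const; congr ((_ - _) / _).
  by rewrite -[in RHS]cardDC mulr_natl.
have dev_gt : sd om < `|clamped_sum D (v \o om) - n%:R * c|.
  have : half_width (hi om - lo om) <
      `|clamped_sum D (v \o om) / n%:R - c| + `|c - mean|.
    apply: lt_le_trans far _.
    rewrite (_ : _ - mean = (clamped_sum D (v \o om) / n%:R - c) + (c - mean)).
      exact: ler_normD.
    by ring.
  have : `|c - mean| <= y by rewrite ler_norml; apply/andP; split; lra.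
  have -> : clamped_sum D (v \o om) / n%:R - c =
      (clamped_sum D (v \o om) - n%:R * c) / n%:R by field; rewrite gt_eqF.
  rewrite normrM [`|n%:R^-1|]gtr0_norm ?invr_gt0 // /half_width -/y -/k => ? ?.
  by rewrite /sd -ltr_pdivlMr //; lra.
(* If the pilot range is a point, every clamped value equals it and the sum has no deviation,
   against [dev_gt]. *)
have sd0 : 0 < sd om.
  apply: mulr_gt0 => //; apply: mulr_gt0 => //; rewrite subr_gt0 lt_def.
  rewrite pilot_min_max_sample andbT.
  apply: contraTN dev_gt => /eqP hl.
  have cl x : clamp (lo om) (hi om) x = lo om.
    have /andP[] := clamp_bounds x (pilot_min_max_sample om).
    by rewrite hl => ? ?; apply/eqP; rewrite eq_le; apply/andP.
  have cE : c = lo om.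
    rewrite /c /clamped_mean; under eq_bigr do rewrite cl.
    by rewrite -mulr_suml p_distr.2 mul1r.
  have -> : clamped_sum D (v \o om) = n%:R * c.
    rewrite /clamped_sum cE; under eq_bigr do rewrite cl.
    by rewrite sumr_const -cardDC mulr_natl.
  by rewrite subrr normr0 /sd hl subrr !mul0r ltxx.
rewrite /chebyshev devE -real_normK ?num_real // normrM.
rewrite [`|(sd om)^-1|]gtr0_norm ?invr_gt0 //; apply: exprn_ege1.
by rewrite ler_pdivlMr // mul1r ltW.
Qed.

Lemma mean_bounds : 0 <= mean <= 1.
Proof.
apply/andP; split.
  by apply: sumr_ge0 => x _; rewrite mulr_ge0 ?p_distr.1 //;
    have /andP[] := v01 x.
rewrite -p_distr.2; apply: ler_sum => x _.
by rewrite ler_piMr ?p_distr.1 //; have /andP[] := v01 x.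
Qed.

Lemma range_tail (delta B : R) : 0 <= delta ->
  \sum_(x | delta <= v x - mean) p x <= B ->
  \sum_(x | delta <= mean - v x) p x <= B ->
  expect (fun om => (2 * delta < hi om - lo om)%R%:R) <= 2 * n%:R * B.
Proof.
move=> delta0 up down.
have up_down r : expect (fun om => (delta <= v (om r) - mean)%R%:R +
    (delta <= mean - v (om r))%R%:R) <= 2 * B.
  have toB (e : pred V) : \sum_(x | e x) p x <= B ->
      expect (fun om => (e (om r))%:R) <= B.
    apply: le_trans; rewrite (expect_marginal (fun x => (e x)%:R)).
    rewrite [leRHS]big_mkcond; apply: ler_sum => x _.
    by case: ifP; rewrite ?mulr1 ?mulr0.
  by rewrite expectD; have := toB _ up; have := toB _ down; lra.
apply: (@le_trans _ _ (\sum_(r | D r) 2 * B)); last first.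
  by rewrite sumr_const cardD -mulr_natl; lra.
apply: le_trans (ler_sum _ (fun r _ => up_down r)); rewrite -expect_sum.
apply: ler_expect => om; case: ltP => [wide|_]; last first.
  by apply: sumr_ge0 => r _; rewrite addr_ge0.
have [r /andP[Dr rP]|none] := pickP (fun r => D r &&
    ((delta <= v (om r) - mean)%R || (delta <= mean - v (om r))%R)).
  rewrite (bigD1 r) //= -[leLHS]addr0 lerD //; last first.
    by apply: sumr_ge0 => s _; rewrite addr_ge0.
  by case/orP: rP => ->; rewrite ?lerDl ?lerDr.
have near r : D r -> mean - delta <= v (om r) <= mean + delta.
  move=> Dr; have := none r; rewrite Dr /= => /negbT.
  by rewrite negb_or -!ltNge => /andP[? ?]; apply/andP; split; lra.
(* These bounds place the neutral elements 0 and 1 of the maximum and minimum on the right side of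
   mean + delta and mean - delta. *)
have /andP[mean0 mean1] := mean_bounds.
have : hi om <= mean + delta.
  apply: bigmax_le => [|r /near /andP[]//]; lra.
have : mean - delta <= lo om.
  by apply/bigmin_geP; split => [|r /near /andP[]//]; lra.
by lra.
Qed.

End Sampling.

(** * Independent chains and the interval *)

Lemma measure_finite_valued d (T : measurableType d) (R : realType)
    (mu : {measure set T -> \bar R}) (V : finType) (Y : T -> V) (Q : pred V) :
  (forall v, measurable [set t | Y t = v]) ->
  mu [set t | Q (Y t)] = (\sum_(v | Q v) mu [set t | Y t = v])%E.
Proof.
move=> mY.
have seqP (s : seq V) : uniq s -> measurable [set t | Y t \in s] /\
    mu [set t | Y t \in s] = (\sum_(v <- s) mu [set t | Y t = v])%E.
  elim: s => [|v s IH] /= => [_|/andP[vs /IH[ms mus]]].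
    rewrite big_nil (_ : [set _ | _] = set0) ?measure0 //.
    by apply/seteqP; split.
  have -> : [set t | Y t \in v :: s] =
      [set t | Y t = v] `|` [set t | Y t \in s].
    apply/seteqP; split => t /=; rewrite inE.
      by case/predU1P; [left|right].
    by case=> [->|->]; rewrite ?eqxx ?orbT.
  split; first exact: measurableU.
  have disj : [set t | Y t = v] `&` [set t | Y t \in s] = set0.
    by apply/seteqP; split => // t /= [->]; rewrite (negPf vs).
  by rewrite big_cons -mus; exact: measureU.
transitivity (\sum_(v <- enum Q) mu [set t | Y t = v])%E.
  have [_ <-] := seqP _ (enum_uniq Q).
  by congr (mu _); apply/seteqP; split => t /=; rewrite mem_enum.
by rewrite big_enum.
Qed.

Section Law.
Variables (R : realType) (S : finType) (pi : S -> R) (K : S -> S -> R).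
Variables (d : measure_display) (T : measurableType d) (P : probability T R).

Lemma markov_chain_path_law m (X : 'I_m.+1 -> T -> S)
    (x : {ffun 'I_m.+1 -> S}) :
  markov_chain P pi K X ->
  P [set t | [ffun j => X j t] = x] = (path_weight pi K x)%:E.
Proof.
move=> [_ X0 XS].
have prefix k : (k <= m)%N ->
    P [set t | forall i : 'I_m.+1, (i <= k)%N -> X i t = x i] =
    (pi (x ord0) * \prod_(j < k) K (x (inord j)) (x (inord j.+1)))%:E.
  elim: k => [_|k IH km].
    rewrite big_ord0 mulr1 -X0; congr (P _); apply/seteqP; split => t /=.
      exact.
    move=> e i; rewrite leqn0 => /eqP i0.
    by have -> : i = ord0 by exact: val_inj.
  have := XS x (Ordinal km); rewrite /= => ->.
  by rewrite IH ?(ltnW km) // -EFinM big_ord_recr /= mulrA.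
rewrite -prefix //; congr (P _); apply/seteqP; split => t /=.
  by move=> <- i _; rewrite ffunE.
by move=> e; apply/ffunP => i; rewrite ffunE e // -ltnS.
Qed.

Lemma measurable_path m (X : 'I_m.+1 -> T -> S) (x : {ffun 'I_m.+1 -> S}) :
  markov_chain P pi K X -> measurable [set t | [ffun j => X j t] = x].
Proof.
move=> [mX _ _].
have -> : [set t | [ffun j => X j t] = x] =
    \bigcap_(j in [set: 'I_m.+1]) [set t | X j t = x j].
  apply/seteqP; split => t /= => [<- j _|e]; first by rewrite /= ffunE.
  by apply/ffunP => j; rewrite ffunE; exact: (e j I).
by apply: fin_bigcap_measurable => // j _; exact: mX.
Qed.

(** Transfers events to the finite product space: independence on singletons factors the law of the
    family of paths, and each factor is a path weight. *)
Lemma chains_law N m (X : 'I_N -> 'I_m.+1 -> T -> S)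
    (Q : pred {ffun 'I_N -> {ffun 'I_m.+1 -> S}}) :
  independent_markov_chains P pi K X ->
  P [set t | Q [ffun r => [ffun j => X r j t]]] =
  (expect (@path_weight R S pi K m) (fun om => (Q om)%:R))%:E.
Proof.
move=> [chainX indX].
have eqset om : [set t | [ffun r => [ffun j => X r j t]] = om] =
    \bigcap_(r in [set: 'I_N]) [set t | [ffun j => X r j t] = om r].
  apply/seteqP; split => t /= => [<- r _|e]; first by rewrite /= ffunE.
  by apply/ffunP => r; rewrite ffunE; exact: (e r I).
rewrite (@measure_finite_valued _ _ _ P _
  (fun t => [ffun r => [ffun j => X r j t]])); last first.
  move=> om; rewrite eqset; apply: fin_bigcap_measurable => // r _.
  exact: measurable_path.
rewrite /expect -sumEFin big_mkcond; apply: eq_bigr => om _.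
case: ifP => _; last by rewrite mulr0.
rewrite mulr1 /sample_weight -prodEFin.
have := indX [set: 'I_N]%SET (fun r => [set om r]).
under eq_bigr => r _ do rewrite /= (markov_chain_path_law _ (chainX r)).
rewrite big_mkcond /=; under [in RHS]eq_bigr do rewrite inE.
move=> <-; congr (P _); apply/seteqP; split => t /=.
  by move=> <- r _; rewrite ffunE.
by move=> e; apply/ffunP => r; rewrite ffunE; apply: e; rewrite inE.
Qed.

End Law.

(** * Center and radius as functions of the data matrix *)

Section Interval.
Variables (R : realType) (n m : nat) (alpha : R).

Definition pilot : pred 'I_(2 * n) := fun r => (r < n)%N.

Lemma card_pilot : #|pilot| = n.
Proof.
rewrite -sum1_card (eq_bigl (fun r : 'I_(2 * n) => (r < n)%N)) //.
by rewrite -(big_ord_widen _ (fun=> 1%N)) ?sum1_card ?card_ord // leq_pmull.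
Qed.

Lemma card_predC_pilot : #|predC pilot| = n.
Proof.
apply/eqP; rewrite -(eqn_add2l #|pilot|) cardC card_ord card_pilot.
by rewrite mul2n addnn.
Qed.

Definition row_mean (x : 'M[R]_(2 * n, m.+1)) (r : 'I_(2 * n)) : R :=
  (\sum_j x r j) / m.+1%:R.

Definition center (x : 'M[R]_(2 * n, m.+1)) : R :=
  clamped_sum pilot (row_mean x) / n%:R.

Definition radius (x : 'M[R]_(2 * n, m.+1)) : R :=
  half_width n alpha
    (pilot_max pilot (row_mean x) - pilot_min pilot (row_mean x)).

End Interval.

(** * Elementary estimates for the exponential and the logarithm *)

Lemma expR1_le3 (R : realType) : expR (1 : R) <= 3.
Proof.
have -> : (1 : R) = 6^-1 * 6%:R by field.
rewrite expRM_natr.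
(* From exp(-1/6) >= 5/6; the sixth power of 6/5 is just below 3. *)
have h : expR (6^-1 : R) <= 6 / 5.
  rewrite -[leLHS]invrK -expRN -[leRHS]invrK lef_pV2
    ?posrE ?invr_gt0 ?expR_gt0 //.
  have := expR_ge1Dx (- 6^-1 : R); lra.
apply: le_trans (lerXn2r 6 _ _ h) _; rewrite ?nnegrE ?expR_ge0 //; lra.
Qed.

Lemma ln_nat_ge1 (R : realType) n : (3 <= n)%N -> 1 <= ln (n%:R : R).
Proof.
move=> n3; have n0 : 0 < n%:R :> R by rewrite ltr0n (leq_trans _ n3).
rewrite -[leLHS]expRK ler_ln ?posrE ?expR_gt0 //.
by apply: le_trans (expR1_le3 R) _; rewrite ler_nat.
Qed.

(* With [x = y ^ 4] the claim becomes [0 <= (y - 2) ^ 2]. *)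
Lemma ln_le_sqrt (R : realType) (x : R) : 0 < x -> ln x <= Num.sqrt x.
Proof.
move=> x0; pose y := Num.sqrt (Num.sqrt x).
have y0 : 0 < y by rewrite !sqrtr_gt0.
have y2 : y ^+ 2 = Num.sqrt x by rewrite sqr_sqrtr.
have y4 : y ^+ 4 = x by rewrite (exprM y 2 2) y2 sqr_sqrtr // ltW.
have lny : ln y <= y - 1.
  by have := le_ln1Dx (x := y - 1); rewrite subrKC; apply; lra.
rewrite -y2 -[in leLHS]y4 lnXn // -mulr_natr.
have : 0 <= (y - 2) ^+ 2 by exact: sqr_ge0.
by rewrite !expr2; lra.
Qed.

(** An infinite relaxation time has inverse 0, in agreement with 1 - lambda_2 = 0; otherwise the
    inverse is taken in the reals. *)
Lemma expeR_relaxation_time (R : realType) (n m : nat) (lambda : seq R)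
    (c : R) :
  (0 < n)%N ->
  expeR (- (m%:R%:E / ((48 * n%:R)%:E * relaxation_time lambda) * c%:E))%E =
  (expR (- (m%:R * (1 - lambda`_1) / (48 * n%:R) * c)))%:E.
Proof.
move=> n0; have n48 : 0 < 48 * n%:R :> R by rewrite mulr_gt0 ?ltr0n.
rewrite /relaxation_time; case: ifPn => [/eqP ->|l1].
  by rewrite gt0_muley ?lte_fin // invey mule0 mul0e oppe0 expeR0 subrr mulr0
    !mul0r oppr0 expR0.
have l1' : 1 - lambda`_1 != 0 by rewrite subr_eq0 eq_sym.
have -> : ((48 * n%:R)%:E * ((1 - lambda`_1)^-1)%:E)%E =
  (48 * n%:R * (1 - lambda`_1)^-1)%:E by [].
rewrite inver mulf_eq0 invr_eq0 (gt_eqF n48) (negPf l1') /=.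
rewrite /= invfM invrK; congr (expR (- _))%:E.
by rewrite [_^-1 * _]mulrC !mulrA.
Qed.

(** * Range of the pilot averages of the chains *)

Section ChainRange.
Variables (R : realType) (S : finType) (pi : S -> R) (K : S -> S -> R).
Hypotheses (pi_distr : is_distribution pi) (K_stoch : is_transition_matrix K).
Hypothesis K_rev : reversible pi K.
Variables (g : S -> R) (n m : nat).
Hypotheses (g01 : forall i, 0 <= g i <= 1) (n_ge3 : (3 <= n)%N).

Let p := @path_weight R S pi K m.
Let gbar := \sum_i pi i * g i.

Definition path_mean (x : {ffun 'I_m.+1 -> S}) : R :=
  (\sum_j g (x j)) / m.+1%:R.

Lemma path_mean_mean : \sum_x p x * path_mean x = gbar.
Proof.
under eq_bigr do rewrite /path_mean mulrA mulr_sumr.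
rewrite -mulr_suml exchange_big /=.
under eq_bigr do rewrite path_weight_marginal //.
by rewrite sumr_const card_ord -[X in X / _]mulr_natr mulfK // pnatr_eq0.
Qed.

Lemma path_mean_bounds x : 0 <= path_mean x <= 1.
Proof.
rewrite /path_mean ler_pdivrMr ?ltr0n // mul1r.
rewrite divr_ge0 //=; last by apply: sumr_ge0 => j _; have /andP[] := g01 (x j).
apply: (@le_trans _ _ (\sum_(j < m.+1) 1)); last by rewrite sumr_const card_ord.
by apply: ler_sum => j _; have /andP[] := g01 (x j).
Qed.

Lemma pilot_range_tail (lambda : seq R) :
  (2 <= #|S|)%N -> eigenvalues K lambda ->
  expect p (fun om : {ffun 'I_(2 * n) -> _} =>
    (2 * (ln n%:R / Num.sqrt n%:R) <
     pilot_max (@pilot n) (path_mean \o om) -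
     pilot_min (@pilot n) (path_mean \o om))%R%:R) <=
  3 * n%:R * (n%:R + 1) *
  expR (- (m%:R * (1 - lambda`_1) / (48 * n%:R) * ln n%:R ^+ 2)).
Proof.
move=> S2 eigK.
have p_distr : is_distribution p by exact: path_weight_distr.
have n0 : (0 < n)%N by exact: leq_trans n_ge3.
have nR : 0 < n%:R :> R by rewrite ltr0n.
have n3 : 3 <= n%:R :> R by rewrite ler_nat.
have [delta deltaE] : exists delta, ln n%:R / Num.sqrt n%:R = delta :> R.
  by eexists.
have sn : 0 < Num.sqrt n%:R :> R by rewrite sqrtr_gt0.
have delta_ge0 : 0 <= delta.
  by rewrite -deltaE divr_ge0 ?(ltW sn) // (le_trans ler01) ?ln_nat_ge1.
have delta_le1 : delta <= 1 by rewrite -deltaE ler_pdivrMr // mul1r ln_le_sqrt.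
have delta2 : delta ^+ 2 = ln n%:R ^+ 2 / n%:R.
  by rewrite -deltaE expr_div_n sqr_sqrtr ?ltW.
have : lambda`_1 \in lambda by rewrite mem_nth // (size_eigenvalues eigK).
move=> /(eigenvalues_norm_le1 K_stoch eigK); rewrite ler_norml => /andP[l1 l2].
have [gamma gammaE] : exists gamma, 1 - lambda`_1 = gamma by eexists.
rewrite gammaE deltaE; have [gamma0|gamma_gt0] := leP gamma 0.
  (* Without a gap the exponential is 1, and n >= 3 makes the prefactor at least 36, above any
     probability. *)
  have -> : gamma = 0 by apply/eqP; rewrite eq_le gamma0 -gammaE; lra.
  rewrite mulr0 !mul0r oppr0 expR0 mulr1.
  apply: (@le_trans _ _ (expect p (fun _ : {ffun 'I_(2 * n) -> _} => 1))).
    by apply: ler_expect => // om; case: (_ < _).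
  rewrite expect_cst //.
  have : 3 * 3 * 4 <= 3 * n%:R * (n%:R + 1) :> R by apply: ler_pM; lra.
  by lra.
have gamma_le2 : gamma <= 2 by rewrite -gammaE; lra.
(* As delta <= 1, this meets [6 * theta <= gamma]; the terms in m of the exponent add up to (-1/6 +
   1/18) gamma delta^2 m = - gamma delta^2 m / 9. *)
pose theta := gamma * delta / 6.
have theta_ge0 : 0 <= theta by rewrite divr_ge0 // mulr_ge0 // ltW.
have theta_le : 6 * theta <= gamma.
  by rewrite /theta mulrC divfK // ler_piMr // ltW.
have gap (w : S -> R) : \sum_i pi i * w i = 0 ->
    form pi K w w <= (1 - gamma) * \sum_i pi i * w i ^+ 2.
  by move=> w0; rewrite -gammaE subKr; exact: spectral_gap.
pose f i := g i - gbar.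
have gbar01 : 0 <= gbar <= 1.
  apply/andP; split.
    by apply: sumr_ge0 => i _; rewrite mulr_ge0 ?pi_distr.1 //;
      have /andP[] := g01 i.
  rewrite -pi_distr.2; apply: ler_sum => i _.
  by rewrite ler_piMr ?pi_distr.1 //; have /andP[] := g01 i.
have f_le1 i : `|f i| <= 1.
  rewrite ler_norml /f; have /andP[? ?] := g01 i; have /andP[? ?] := gbar01.
  by apply/andP; split; lra.
have f_mean : \sum_i pi i * f i = 0.
  under eq_bigr do rewrite mulrBr.
  by rewrite sumrB -mulr_suml pi_distr.2 mul1r subrr.
have meanE (x : {ffun 'I_m.+1 -> S}) :
    path_mean x - gbar = (\sum_i f (x i)) / m.+1%:R.
  by rewrite sumrB sumr_const card_ord mulrBl -[gbar *+ _]mulr_natr mulfK //.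
pose B :=
  expR (theta - theta * m.+1%:R * delta + 2 * theta ^+ 2 / gamma * m%:R).
have up : \sum_(x | delta <= path_mean x - \sum_y p y * path_mean y) p x <= B.
  rewrite path_mean_mean; under eq_bigl do rewrite meanE.
  exact: path_tail.
have down : \sum_(x | delta <= (\sum_y p y * path_mean y) - path_mean x) p x
    <= B.
  rewrite path_mean_mean.
  under eq_bigl do rewrite -opprB meanE -mulNr -sumrN.
  apply: (@path_tail _ _ _ _ pi_distr K_stoch K_rev _ _ (fun i => - f i)) => //.
    by move=> i; rewrite normrN.
  by under eq_bigr do rewrite mulrN; rewrite sumrN f_mean oppr0.
apply: le_trans (@range_tail R _ p _ p_distr (@pilot n) path_mean n
  path_mean_bounds (card_pilot n) delta B delta_ge0 up down) _.
(* The remaining [theta], at most 1/3, is absorbed by e <= 3, and -1/9 is relaxed to -1/48. *)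
have BE : B <= 3 * expR (- (m%:R * gamma / (48 * n%:R) * ln n%:R ^+ 2)).
  apply: le_trans (ler_wpM2r (expR_ge0 _) (expR1_le3 R)).
  rewrite -expRD ler_expR.
  have -> : m%:R * gamma / (48 * n%:R) * ln n%:R ^+ 2 =
      gamma * delta ^+ 2 * m%:R / 48 by rewrite delta2; field; rewrite gt_eqF.
  have -> : theta * m.+1%:R * delta = gamma * delta ^+ 2 * m%:R / 6 +
      gamma * delta ^+ 2 / 6 by rewrite -natr1 /theta; field.
  have -> : 2 * theta ^+ 2 / gamma * m%:R = gamma * delta ^+ 2 * m%:R / 18.
    by rewrite /theta; field; rewrite gt_eqF.
  have : 0 <= gamma * delta ^+ 2 by rewrite mulr_ge0 ?sqr_ge0 // ltW.
  have : 0 <= gamma * delta ^+ 2 * m%:R by rewrite !mulr_ge0 ?sqr_ge0 // ltW.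
  by lra.
(* The 2 n tails with factor 3 total 6 n <= 3 n (n + 1). *)
apply: le_trans (ler_wpM2l _ BE) _; first by rewrite mulr_ge0.
rewrite mulrA ler_wpM2r ?expR_ge0 //.
have : n%:R * 3 <= n%:R * n%:R :> R by rewrite ler_wpM2l // ltW.
by lra.
Qed.

End ChainRange.

(** A range of order ln n / sqrt n times the Chebyshev factor of order 1 / sqrt n gives ln n / n,
    and the clamping term is enlarged by ln n >= 1. The sum is [k_const alpha] times ln n / n. *)
Lemma length_le (R : realType) (n : nat) (alpha range t : R) :
  (3 <= n)%N -> 0 < alpha < 1 -> 1 / n%:R <= t ->
  range <= 2 * (ln n%:R / Num.sqrt n%:R) ->
  2 * half_width n alpha range <= k_const alpha * t * ln n%:R.
Proof.
move=> n_ge3 /andP[a0 a1] tn range_le.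
have nR : 0 < n%:R :> R by rewrite ltr0n (leq_trans _ n_ge3).
have [l lE] : exists l, ln n%:R = l :> R by eexists.
have l1 : 1 <= l by rewrite -lE ln_nat_ge1.
have [q qE] : exists q, Num.sqrt n%:R = q :> R by eexists.
have sn : 0 < q by rewrite -qE sqrtr_gt0.
have [b bE] : exists b, ln (4 / alpha) = b by eexists.
have b0 : 0 <= b.
  by rewrite -bE ln_ge0 // ler_pdivlMr // mul1r; lra.
have [c cE] : exists c, Num.sqrt (2 / alpha) = c by eexists.
have c0 : 0 <= c by rewrite -cE sqrtr_ge0.
rewrite /k_const /half_width bE cE lE qE in range_le *.
have s2 : q * q = n%:R by rewrite -qE -expr2 sqr_sqrtr ?ltW.
have h1 : range * (c / (2 * q)) <= l * c / n%:R.
  have -> : l * c / n%:R = 2 * (l / q) * (c / (2 * q)).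
    by rewrite -s2; field; rewrite gt_eqF.
  by rewrite ler_wpM2r // divr_ge0 // mulr_ge0 // ltW.
have h2 : b / n%:R <= l * b / n%:R.
  by rewrite ler_wpM2r ?invr_ge0 ?(ltW nR) // ler_peMl.
have h3 : 2 * (c + b) * (1 / n%:R) * l <= 2 * (c + b) * t * l.
  rewrite ler_wpM2r //; first lra.
  by rewrite ler_wpM2l // mulr_ge0 // addr_ge0.
apply: le_trans h3.
have -> : 2 * (c + b) * (1 / n%:R) * l = 2 * (l * b / n%:R + l * c / n%:R).
  by field; rewrite gt_eqF.
by rewrite ler_wpM2l // lerD.
Qed.

Theorem theorem2p1 (R : realType) (n m : nat) (alpha tauhat : R)
    (hn : (3 <= n)%N) (hm : (1 <= m)%N)
    (halpha : 0 < alpha < 1) (htau : 1 <= tauhat) :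
  exists L U : 'M[R]_(2 * n, m.+1) -> R,
    (forall x : 'M[R]_(2 * n, m.+1),
       (forall r j, 0 <= x r j <= 1) -> L x <= U x) /\
    forall (S : finType) (pi : S -> R) (K : S -> S -> R) (g : S -> R),
      is_distribution pi -> is_transition_matrix K -> reversible pi K ->
      (forall i, 0 <= g i <= 1) ->
    forall (d : measure_display) (T : measurableType d) (P : probability T R)
           (X : 'I_(2 * n) -> 'I_m.+1 -> T -> S),
      independent_markov_chains P pi K X ->
    let G (t : T) : 'M[R]_(2 * n, m.+1) := \matrix_(r, j) g (X r j t) in
    let gbar : R := \sum_i pi i * g i in
    (P [set t | (gbar \notin `[L (G t), U (G t)])%R] <= alpha%:E)%E /\
    forall lambda : seq R,
      (2 <= #|S|)%N -> eigenvalues K lambda ->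
      (P [set t | (U (G t) - L (G t) >
                   k_const alpha *
                   Num.max (1 / n%:R) (Num.sqrt (tauhat / (n%:R * m%:R))) *
                   ln n%:R)%R]
       <= (3 * n%:R * (n%:R + 1))%:E *
          expeR (- (m%:R%:E / ((48 * n%:R)%:E * relaxation_time lambda) *
                    ((ln n%:R) ^+ 2)%:E)))%E.
Proof.
have n0 : (0 < n)%N by exact: leq_trans hn.
have /andP[alpha0 alpha1] := halpha.
exists (fun x => center x - radius alpha x), (fun x => center x + radius alpha x).
split=> [x x01|S pi K g pi_distr K_stoch K_rev g01 d T P X chains G gbar].
  have radius0 : 0 <= radius alpha x.
    have r0 : 'I_(2 * n) by exists 0%N; rewrite muln_gt0.
    rewrite addr_ge0 ?divr_ge0 ?mulr_ge0 ?divr_ge0 ?mulr_ge0 ?sqrtr_ge0 //.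
      by rewrite ln_ge0 // ler_pdivlMr // mul1r; lra.
    have [r Dr] := @pilot_nonempty _ (@pilot n) n n0 (card_pilot n).
    by rewrite subr_ge0; exact: pilot_min_max Dr.
  lra.
(* The data matrix factors through the finite space of path families, where [chains_law] applies. *)
pose Gm (om : {ffun 'I_(2 * n) -> {ffun 'I_m.+1 -> S}}) : 'M[R]_(2 * n, m.+1) :=
  \matrix_(r, j) g (om r j).
have GE t : G t = Gm [ffun r => [ffun j => X r j t]].
  by apply/matrixP => r j; rewrite !mxE !ffunE.
have rowE om : row_mean (Gm om) = path_mean g (m := m) \o om.
  apply/funext => r; rewrite /row_mean /path_mean /=; congr (_ / _).
  by apply: eq_bigr => j _; rewrite mxE.
have p_distr : is_distribution (@path_weight R S pi K m).
  exact: path_weight_distr.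
have meanE := path_mean_mean K_stoch K_rev g m.
split=> [|lambda S2 eigK].
  under eq_set do rewrite GE.
  rewrite (chains_law (fun om => gbar \notin
    `[center (Gm om) - radius alpha (Gm om),
      center (Gm om) + radius alpha (Gm om)]) chains) lee_fin.
  have := @coverage R _ _ _ p_distr (@pilot n) (path_mean g (m := m)) n alpha
    (path_mean_bounds g01) n0 (card_pilot n) (card_predC_pilot n) alpha0.
  apply: le_trans; apply: ler_expect => // om.
  rewrite meanE -/gbar /center /radius rowE in_itv /= ler_distl.
  by rewrite !lerBlDr andbC.
rewrite expeR_relaxation_time // -EFinM.
under eq_set do rewrite GE.
set thr := k_const alpha * _ * _.
rewrite (chains_law (fun om => (thr < center (Gm om) + radius alpha (Gm om) -
  (center (Gm om) - radius alpha (Gm om)))%R) chains) lee_fin.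
have := pilot_range_tail pi_distr K_stoch K_rev m g01 hn S2 eigK.
apply: le_trans; apply: ler_expect => // om.
(* Contrapositive of [length_le]: excess length forces a wide pilot range. *)
rewrite -rowE; case: ltP => // wide.
case: ltP => // narrow; move: wide; rewrite ltNge => /negP[].
have -> : center (Gm om) + radius alpha (Gm om) -
  (center (Gm om) - radius alpha (Gm om)) = 2 * radius alpha (Gm om) by ring.
by apply: length_le => //; rewrite le_max lexx.
Qed.
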